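(* Let $\Sigma=\mathbb{D}/\Gamma$ be a compact Riemann surface of genus $\ge2$. For every integer $N\ge 2$ and $(z,w)\in\mathbb{D}\times\mathbb{D}$, $$I\Big(\sum_{\gamma\in\Gamma}\gamma^*d\tau^{\otimes N}\Big)(z,w)=\sum_{\gamma\in\Gamma}(\gamma(w)-\gamma(z))^N,$$ where $\sum_{\gamma\in\Gamma}\gamma^*d\tau^{\otimes N}\in H^0(\mathbb{D},K_{\mathbb{D}}^{\otimes N})$ is regarded as a holomorphic $N$-differential on $\Sigma$.
   Context: $\mathbb{D}\subset\mathbb{C}$ is the unit disk with coordinate $\tau$, $\Gamma<\mathrm{Aut}(\mathbb{D})=PSU(1,1)$ is a Fuchsian group such that $\mathbb{D}\to\Sigma=\mathbb{D}/\Gamma$ is the universal covering of a compact Riemann surface of genus $\ge 2$. Holomorphic $N$-differentials on $\Sigma$, i.e. elements of $H^0(\Sigma,K_\Sigma^{\otimes N})$, are identified with $\Gamma$-invariant holomorphic differentials $\psi(\tau)(d\tau)^{\otimes N}$ on $\mathbb{D}$. Here $\gamma^*d\tau^{\otimes N}=\gamma'(\tau)^N(d\tau)^{\otimes N}$; for $N\ge2$ the Poincaré series $\sum_{\gamma\in\Gamma}\gamma^*d\tau^{\otimes N}$ converges uniformly on compact subsets of $\mathbb{D}$. For $N\ge1$ and $\psi=\psi(\tau)(d\tau)^{\otimes N}\in H^0(\Sigma,K_\Sigma^{\otimes N})$, $I(\psi)$ is the $\Gamma$-invariant (for the diagonal action) holomorphic function on $\mathbb{D}\times\mathbb{D}$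 given by $$I(\psi)(z,w)=\frac{1}{\mathrm{B}(N,N)}\int_z^w\left(\frac{(w-\tau)(\tau-z)}{w-z}\right)^{N-1}\psi(\tau)\,d\tau$$ for $z\neq w$ (along any path in $\mathbb{D}$ from $z$ to $w$), extended by $0$ to $z=w$; $\mathrm{B}(p,q)$ is the beta function. *)

(* Defs.v *)
(* Stdlib reals with Coquelicot's complex numbers. *)
From Stdlib Require Import Reals List.
From Coquelicot Require Import Coquelicot.
Local Open Scope C_scope.

Definition disk : Type := {z : C | Cmod z < 1}.

Definition disk_val (z : disk) : C := proj1_sig z.
Coercion disk_val : disk >-> C.

(* Extension by 0, so that Coquelicot's calculus on C applies; derivatives at a
   point of the open disk do not depend on the values outside it. *)
Definition ext (f : disk -> C) : C -> C := fun z =>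
  match Rlt_dec (Cmod z) 1 with
  | left h => f (exist _ z h)
  | right _ => 0
  end.

Definition holomorphic (f : disk -> C) : Prop :=
  forall z : disk, ex_derive (K := C_AbsRing) (V := C_NormedModule) (ext f) (disk_val z).

(* The complex derivative g'(z) of a self-map of the disk. *)
Definition deriv (g : disk -> disk) (z : disk) : C :=
  C_derive (ext (fun x => g x : C)) z.

(* Sums over an arbitrary index set: the limit along the directed set of finite
   subsets of A (unconditional convergence). *)
Definition Csum {T : Type} (l : list T) (f : T -> C) : C :=
  fold_right (fun x s => f x + s) 0 l.

Definition is_usum {T : Type} (A : T -> Prop) (f : T -> C) (s : C) : Prop :=
  forall eps : posreal, exists l0 : list T,
    NoDup l0 /\ List.Forall A l0 /\
    forall l : list T, NoDup l -> List.Forall A l -> incl l0 l ->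
      Cmod (Csum l f - s) < eps.

Definition summable {T : Type} (A : T -> Prop) (f : T -> C) : Prop :=
  exists s : C, is_usum A f s.

(* Meaningful when f is summable on A. *)
Definition usum {T : Type} (A : T -> Prop) (f : T -> C) : C :=
  @iota C_CompleteNormedModule (is_usum A f).

(* g is the automorphism given by the matrix (a, b; conj b, conj a) of SU(1,1).
   Elements of Aut(D) = PSU(1,1) are taken to be maps disk -> disk, so that the
   matrices (a, b) and (-a, -b) give the same element. *)
Definition su11_map (a b : C) (g : disk -> disk) : Prop :=
  (Cmod a ^ 2 - Cmod b ^ 2 = 1)%R /\
  forall z : disk, (g z : C) = (a * z + b) / (Cconj b * z + Cconj a).

(* Discreteness is that of the subspace topology from PSU(1,1), itself a
   quotient of SU(1,1). *)
Record fuchsian (Gamma : (disk -> disk) -> Prop) : Prop := {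
  fuchsian_psu11 : forall g, Gamma g -> exists a b, su11_map a b g;
  fuchsian_id : Gamma (fun z => z);
  fuchsian_comp : forall g h, Gamma g -> Gamma h -> Gamma (fun z => g (h z));
  fuchsian_inv : forall g, Gamma g ->
    exists h, Gamma h /\ (forall z, h (g z) = z) /\ (forall z, g (h z) = z);
  fuchsian_discrete : forall g a b, Gamma g -> su11_map a b g ->
    exists eps : posreal, forall h a' b', Gamma h -> su11_map a' b' h ->
      Cmod (a' - a) < eps -> Cmod (b' - b) < eps -> h = g
}.

Definition disk_open (U : disk -> Prop) : Prop :=
  open (fun z : C => exists h : Cmod z < 1, U (exist _ z h)).

(* The surface Sigma = D / Gamma, as the space of orbits. *)
Definition orbit (Gamma : (disk -> disk) -> Prop) (z : disk) : disk -> Prop :=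
  fun w => exists g, Gamma g /\ w = g z.

Definition surface (Gamma : (disk -> disk) -> Prop) : Type :=
  {O : disk -> Prop | exists z, O = orbit Gamma z}.

Definition proj (Gamma : (disk -> disk) -> Prop) (z : disk) : surface Gamma :=
  exist _ (orbit Gamma z) (ex_intro _ z eq_refl).

(* Quotient topology. *)
Definition surface_open (Gamma : (disk -> disk) -> Prop)
    (V : surface Gamma -> Prop) : Prop :=
  disk_open (fun z => V (proj Gamma z)).

Definition surface_hausdorff (Gamma : (disk -> disk) -> Prop) : Prop :=
  forall x y : surface Gamma, x <> y ->
    exists U V, surface_open Gamma U /\ surface_open Gamma V /\
      U x /\ V y /\ forall t, ~ (U t /\ V t).

Definition surface_compact (Gamma : (disk -> disk) -> Prop) : Prop :=
  forall (I : Type) (V : I -> surface Gamma -> Prop),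
    (forall i, surface_open Gamma (V i)) ->
    (forall x, exists i, V i x) ->
    exists l : list I, forall x, exists i, In i l /\ V i x.

(* Every point has an open neighbourhood V whose preimage is a disjoint union of
   open sheets U j, each mapped bijectively and openly onto V; continuity is
   built into the quotient topology. *)
Definition proj_covering (Gamma : (disk -> disk) -> Prop) : Prop :=
  forall x : surface Gamma, exists V : surface Gamma -> Prop,
    surface_open Gamma V /\ V x /\
    exists (J : Type) (U : J -> disk -> Prop),
      (forall j, disk_open (U j)) /\
      (forall i j z, U i z -> U j z -> i = j) /\
      (forall z, V (proj Gamma z) <-> exists j, U j z) /\
      (forall j,
        (forall z z', U j z -> U j z' -> proj Gamma z = proj Gamma z' -> z = z') /\
        (forall y, V y -> exists z, U j z /\ proj Gamma z = y) /\
        (forall W, disk_open W -> (forall z, W z -> U j z) ->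
          surface_open Gamma (fun y => exists z, W z /\ proj Gamma z = y))).

(* psi stands for the differential psi(tau) (d tau)^N; these psi form
   H^0(Sigma, K^N). *)
Definition holo_diff (Gamma : (disk -> disk) -> Prop) (N : nat)
    (psi : disk -> C) : Prop :=
  holomorphic psi /\
  forall g, Gamma g -> forall z, psi (g z) * deriv g z ^ N = psi z.

(* genus = dim H^0(Sigma, K): omega 0, ..., omega (k-1) is a basis. *)
Definition is_genus (Gamma : (disk -> disk) -> Prop) (k : nat) : Prop :=
  exists omega : nat -> disk -> C,
    (forall i, (i < k)%nat -> holo_diff Gamma 1 (omega i)) /\
    (forall c : nat -> C,
      (forall z, Csum (seq 0 k) (fun i => c i * omega i z) = 0) ->
      forall i, (i < k)%nat -> c i = 0) /\
    (forall psi, holo_diff Gamma 1 psi -> exists c : nat -> C,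
      forall z, psi z = Csum (seq 0 k) (fun i => c i * omega i z)).

(* D -> D / Gamma is the universal covering of a compact Riemann surface of
   genus k (the complex structure is the one making the projection holomorphic). *)
Record uniformizes (Gamma : (disk -> disk) -> Prop) (k : nat) : Prop := {
  uniformizes_fuchsian : fuchsian Gamma;
  uniformizes_hausdorff : surface_hausdorff Gamma;
  uniformizes_compact : surface_compact Gamma;
  uniformizes_covering : proj_covering Gamma;
  uniformizes_genus : is_genus Gamma k
}.

(* Sum over Gamma of gamma^* (d tau)^N. *)
Definition poincare (Gamma : (disk -> disk) -> Prop) (N : nat) : disk -> C :=
  fun tau => usum Gamma (fun g => deriv g tau ^ N).

(* Being C^1 on the closed interval [a, b] is expressed by a C^1 extension q. *)
Definition C1_on (p : R -> C) (a b : R) : Prop :=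
  exists q dq : R -> C,
    (forall t, is_derive (K := R_AbsRing) (V := C_R_NormedModule) q t (dq t)) /\
    (forall t, continuous dq t) /\
    (forall t, (a <= t <= b)%R -> p t = q t).

Inductive piecewise_C1 (p : R -> C) : R -> R -> Prop :=
| piecewise_C1_one a b : (a < b)%R -> C1_on p a b -> piecewise_C1 p a b
| piecewise_C1_cat a b c :
    piecewise_C1 p a b -> piecewise_C1 p b c -> piecewise_C1 p a c.

Definition disk_path (p : R -> C) (z w : disk) : Prop :=
  piecewise_C1 p 0 1 /\ p 0%R = z /\ p 1%R = w /\
  forall t, (0 <= t <= 1)%R -> Cmod (p t) < 1.

(* The values of Derive at the finitely many break points do not matter. *)
Definition path_deriv (p : R -> C) (t : R) : C :=
  (Derive (fun s => Re (p s)) t, Derive (fun s => Im (p s)) t).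

Definition is_path_integral (f : C -> C) (p : R -> C) (v : C) : Prop :=
  is_RInt (V := C_R_NormedModule) (fun t => f (p t) * path_deriv p t) 0 1 v.

(* Euler's integral, for positive integer arguments. *)
Definition Beta (p q : nat) : R :=
  RInt (fun t => t ^ (p - 1) * (1 - t) ^ (q - 1))%R 0 1.

(* v is the value I(psi)(z, w). *)
Definition is_I (N : nat) (psi : disk -> C) (z w : disk) (v : C) : Prop :=
  (z = w -> v = 0) /\
  (z <> w -> forall p, disk_path p z w ->
    exists J : C,
      is_path_integral
        (fun tau => ((w - tau) * (tau - z) / (w - z)) ^ (N - 1) * ext psi tau)
        p J /\
      v = / Beta N N * J).

(* Main.v *)
Require Import Defs.
From Stdlib Require Import Reals List.
From Coquelicot Require Import Coquelicot.
From Stdlib Require Import Lra Lia Permutation Classical ClassicalEpsilon.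
From Stdlib Require Import FunctionalExtensionality PropExtensionality ProofIrrelevance.
Local Open Scope C_scope.

(** Two facts make the formula true.

    Convergence. Put [weight g = 1 - |g 0|^2], which is [1/|a|^2] when [g] has
    matrix [(a, b; conj b, conj a)]. Since [D -> D / Gamma] is a covering, a
    small disk about the origin has pairwise disjoint images under [Gamma]
    ([deck_small_displacement]); the image under [g] contains a square centred
    at [g 0] with side comparable to [weight g] ([su11_ball_image]). Disjoint
    squares inside a bounded square have bounded total area
    ([square_packing]), so the sums of [weight g ^ 2] over finite subsets of
    [Gamma] are bounded ([sums_bounded_weight]). On a compact subset of the
    disk, both [|g'|^N] and [|g w - g z|^N] are at most a constant times
    [weight g ^ N <= weight g ^ 2].

    The integral of one term. A Moebius map satisfies
    [(gw - gt) (gt - gz) / (gw - gz) = (w - t) (t - z) / (w - z) * g'(t)].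
    With [s = (gt - gz) / (gw - gz)] the integrand attached to [g] is therefore
    [(gw - gz)^N s^(N-1) (1-s)^(N-1) ds] ([substitution]); it is the derivative
    of [(gw - gz)^N] times an incomplete beta polynomial in [s], whose increment
    from [z] to [w] is [(gw - gz)^N B(N, N)].

    Sum and integral are not interchanged. The primitives of the terms are
    summed first, the sum is differentiated term by term
    ([is_cderive_series]), and the fundamental theorem of calculus along the
    path ([is_RInt_path]) gives the integral of the whole series. The families
    of functions that occur have values, derivatives and quadratic Taylor
    remainders bounded uniformly in [g] ([tame]), after a factor dominated by
    [weight g ^ 2] is split off. This estimate is stable under sums and
    products and replaces uniform convergence of derivatives; it also shows
    that the Poincare series is holomorphic. *)

(** * Unconditional sums *)

Section FiniteSets.
Context {T : Type} (A : T -> Prop).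

Definition finset (l : list T) : Prop := NoDup l /\ List.Forall A l.

(** The filter of sections of the directed set of finite subsets of [A]; the
    relation [is_usum] is convergence along it. *)
Definition along_finsets (P : list T -> Prop) : Prop :=
  exists l0, finset l0 /\ forall l, finset l -> incl l0 l -> P l.

Lemma finset_union (l1 l2 : list T) :
  finset l1 -> finset l2 -> exists l, finset l /\ incl l1 l /\ incl l2 l.
Proof.
intros [_ F1] H2; induction l1 as [|x l1 IH].
  exists l2; repeat split; try apply H2; intros y; simpl; tauto.
inversion F1 as [|? ? Ax F1']; subst.
destruct (IH F1') as (l & [Nl Fl] & I1 & I2).
destruct (classic (In x l)) as [Hx|Hx].
  exists l; repeat split; auto.
  intros y [<-|Hy]; auto.
exists (x :: l); split; [split; constructor; auto|].
split; [apply incl_cons; [left; auto|apply incl_tl, I1]|apply incl_tl, I2].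
Qed.

Global Instance along_finsets_filter : ProperFilter along_finsets.
Proof.
split.
  intros P (l0 & H0 & HP); exists l0; apply HP; auto; apply incl_refl.
split.
- exists nil; split; [repeat constructor|auto].
- intros P Q (l1 & H1 & HP) (l2 & H2 & HQ).
  destruct (finset_union l1 l2 H1 H2) as (l & Hl & I1 & I2).
  exists l; split; auto; intros l' Hl' I; split.
    apply HP; auto; eapply incl_tran; eauto.
  apply HQ; auto; eapply incl_tran; eauto.
- intros P Q PQ (l0 & H0 & HP); exists l0; split; auto.
Qed.

Lemma along_finsets_finset : along_finsets finset.
Proof. exists nil; split; [repeat constructor|auto]. Qed.

Lemma is_usum_filterlim (f : T -> C) (s : C) :
  is_usum A f s <->
  filterlim (fun l => Csum l f : C_NormedModule) along_finsets (locally s).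
Proof.
split.
- intros H P HP.
  destruct (locally_norm_le_locally (V := C_NormedModule) s P HP) as [e He].
  destruct (H e) as (l0 & N0 & F0 & H0).
  exists l0; split; [split; auto|].
  intros l [Nl Fl] I; apply He, (H0 l Nl Fl I).
- intros H e.
  assert (L : locally (s : C_NormedModule) (fun x => Cmod (x - s) < e)).
    apply (locally_le_locally_norm (V := C_NormedModule)); exists e; intros y Hy; exact Hy.
  destruct (H _ L) as (l0 & [N0 F0] & H0).
  exists l0; repeat split; auto; intros l Nl Fl I; apply H0; auto; split; auto.
Qed.

Lemma is_usum_unique (f : T -> C) (s t : C) : is_usum A f s -> is_usum A f t -> s = t.
Proof.
rewrite !is_usum_filterlim; intros Hs Ht.
exact (filterlim_locally_unique (V := C_NormedModule) _ _ _ Hs Ht).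
Qed.

Lemma usum_eq (f : T -> C) (s : C) : is_usum A f s -> usum A f = s.
Proof.
intros H; apply (iota_unique (V := C_CompleteNormedModule)); auto.
intros t Ht; eapply is_usum_unique; eauto.
Qed.

Lemma usum_correct (f : T -> C) : summable A f -> is_usum A f (usum A f).
Proof. intros [s Hs]; rewrite (usum_eq f s Hs); exact Hs. Qed.

Lemma Csum_ext (f g : T -> C) (l : list T) :
  List.Forall A l -> (forall i, A i -> f i = g i) -> Csum l f = Csum l g.
Proof. intros F H; induction F; simpl; congruence || (rewrite H, IHF; auto). Qed.

Lemma is_usum_ext (f g : T -> C) (s : C) :
  (forall i, A i -> f i = g i) -> is_usum A f s -> is_usum A g s.
Proof.
intros H; rewrite !is_usum_filterlim; apply filterlim_ext_loc.
apply (filter_imp finset); [|apply along_finsets_finset].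
intros l Fl; apply Csum_ext; [apply Fl|auto].
Qed.

Lemma is_usum_plus (f g : T -> C) (s t : C) :
  is_usum A f s -> is_usum A g t -> is_usum A (fun i => f i + g i) (s + t).
Proof.
rewrite !is_usum_filterlim; intros Hs Ht.
generalize (filterlim_comp_2 _ _ _ Hs Ht (filterlim_plus (V := C_NormedModule) s t)).
apply filterlim_ext; intros l.
induction l as [|x l IH]; unfold plus in *; simpl in *.
  apply Cplus_0_l.
rewrite <- IH; ring.
Qed.

Lemma is_usum_scal (c : C) (f : T -> C) (s : C) :
  is_usum A f s -> is_usum A (fun i => c * f i) (c * s).
Proof.
rewrite !is_usum_filterlim; intros Hs.
generalize (filterlim_comp _ _ _ _ _ _ _ _ Hs (filterlim_scal_r (V := C_NormedModule) c s)).
apply filterlim_ext; intros l.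
induction l as [|x l IH]; unfold scal in *; simpl in *; unfold mult in *; simpl in *.
  apply Cmult_0_r.
rewrite <- IH; ring.
Qed.

Lemma is_usum_minus (f g : T -> C) (s t : C) :
  is_usum A f s -> is_usum A g t -> is_usum A (fun i => f i - g i) (s - t).
Proof.
intros Hs Ht; replace (s - t) with (s + (-(1)) * t) by ring.
apply is_usum_ext with (fun i => f i + (-(1)) * g i); [intros; ring|].
apply is_usum_plus, is_usum_scal; auto.
Qed.

(** ** Domination by a positive family with bounded finite sums *)

Definition Rsum (l : list T) (f : T -> R) : R := fold_right (fun x s => f x + s)%R 0%R l.

Definition sums_bounded (mu : T -> R) (B : R) : Prop :=
  (forall i, A i -> (0 <= mu i)%R) /\ forall l, finset l -> (Rsum l mu <= B)%R.

Lemma Cmod_Csum_le (f : T -> C) (mu : T -> R) (l : list T) :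
  List.Forall A l -> (forall i, A i -> (Cmod (f i) <= mu i)%R) ->
  (Cmod (Csum l f) <= Rsum l mu)%R.
Proof.
intros F H; induction F as [|x l Ax F IH]; simpl.
  rewrite Cmod_0; lra.
specialize (H x Ax); generalize (Cmod_triangle (f x) (Csum l f)); lra.
Qed.

Lemma Csum_app (f : T -> C) (l1 l2 : list T) : Csum (l1 ++ l2) f = Csum l1 f + Csum l2 f.
Proof. induction l1; simpl; [ring|rewrite IHl1; ring]. Qed.

Lemma Rsum_app (f : T -> R) (l1 l2 : list T) : (Rsum (l1 ++ l2) f = Rsum l1 f + Rsum l2 f)%R.
Proof. induction l1; simpl; [ring|rewrite IHl1; ring]. Qed.

Lemma Csum_perm (f : T -> C) (l1 l2 : list T) : Permutation l1 l2 -> Csum l1 f = Csum l2 f.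
Proof. induction 1; simpl; try congruence; ring. Qed.

Lemma incl_perm (l1 l2 : list T) :
  NoDup l1 -> incl l1 l2 -> exists l, Permutation l2 (l1 ++ l).
Proof.
intros N; revert l2; induction N as [|x l1 Hx N IH]; intros l2 I.
  exists l2; apply Permutation_refl.
destruct (in_split x l2 (I x (or_introl eq_refl))) as (m1 & m2 & ->).
destruct (IH (m1 ++ m2)) as [l Hl].
  intros y Hy; specialize (I y (or_intror Hy)).
  apply in_app_iff; apply in_app_iff in I; simpl in I.
  destruct I as [I|[->|I]]; tauto.
exists l; simpl.
eapply Permutation_trans; [apply Permutation_sym, Permutation_middle|].
constructor; auto.
Qed.

(** The finite sums of [f] form a Cauchy net: beyond a finite set whose
    [mu]-sum is within [eps] of the supremum, nothing of mass more than [eps]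
    is left. *)
Lemma summable_dominated (mu : T -> R) (B : R) (f : T -> C) :
  sums_bounded mu B -> (forall i, A i -> (Cmod (f i) <= mu i)%R) -> summable A f.
Proof.
intros [mu0 HB] Hf.
set (E := fun x => exists l, finset l /\ x = Rsum l mu).
destruct (completeness E) as [S [HS1 HS2]].
- exists B; intros x (l & Hl & ->); auto.
- exists 0%R, nil; repeat split; constructor.
set (F := filtermap (fun l => Csum l f : C_NormedModule) along_finsets).
assert (PF : ProperFilter F) by (apply filtermap_proper_filter, along_finsets_filter).
exists (@lim C_CompleteNormedModule F).
apply is_usum_filterlim.
intros P [e He].
apply (filter_imp (F := F) (ball (@lim C_CompleteNormedModule F) e)); [exact He|].
apply (@complete_cauchy C_CompleteNormedModule F PF).
clear P e He; intros e.
destruct (classic (exists l, finset l /\ (S - e < Rsum l mu)%R)) as [(l0 & [N0 F0] & H0)|H0].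
2: {
  assert (S <= S - e)%R; [|destruct e; simpl in *; lra].
  apply HS2; intros x (l & Hl & ->).
  apply Rnot_lt_le; intro; apply H0; eauto. }
exists (Csum l0 f), l0; split; [split; auto|]; intros l Hl I.
apply (norm_compat1 (V := C_NormedModule)).
change (Cmod (Csum l f - Csum l0 f) < e).
destruct (incl_perm l0 l N0 I) as [l' Hp].
rewrite (Csum_perm _ _ _ Hp), Csum_app.
replace (Csum l0 f + Csum l' f - Csum l0 f) with (Csum l' f) by ring.
assert (F' : finset (l0 ++ l')).
  split; [eapply Permutation_NoDup; [apply Hp|apply Hl]|].
  eapply Permutation_Forall; [apply Hp|apply Hl].
assert (Rsum (l0 ++ l') mu <= S)%R by (apply HS1; exists (l0 ++ l'); auto).
rewrite Rsum_app in *.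
destruct F' as [_ F']; apply Forall_app in F'; destruct F' as [_ F'].
generalize (Cmod_Csum_le f mu l' F' Hf); lra.
Qed.

Lemma is_usum_bound (mu : T -> R) (B : R) (f : T -> C) (s : C) :
  sums_bounded mu B -> (forall i, A i -> (Cmod (f i) <= mu i)%R) ->
  is_usum A f s -> (Cmod s <= B)%R.
Proof.
intros [_ HB] Hf Hs; apply le_epsilon; intros e He.
destruct (Hs (mkposreal e He)) as (l & Nl & Fl & H).
specialize (H l Nl Fl (incl_refl l)); simpl in H.
generalize (Cmod_Csum_le f mu l Fl Hf) (HB l (conj Nl Fl)).
generalize (Cmod_triangle (Csum l f) (- (Csum l f - s))); rewrite Cmod_opp.
replace (Csum l f + - (Csum l f - s)) with s by ring; lra.
Qed.

Lemma Rsum_scal (c : R) (f : T -> R) (l : list T) :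
  Rsum l (fun i => c * f i)%R = (c * Rsum l f)%R.
Proof. induction l; simpl; [ring|rewrite IHl; ring]. Qed.

Lemma sums_bounded_scal (c B : R) (mu : T -> R) :
  (0 <= c)%R -> sums_bounded mu B -> sums_bounded (fun i => c * mu i)%R (c * B)%R.
Proof.
intros Hc [H0 H]; split.
  intros i Ai; apply Rmult_le_pos; auto.
intros l Hl; rewrite Rsum_scal; apply Rmult_le_compat_l; auto.
Qed.

End FiniteSets.

Lemma Csum_map {T U : Type} (h : T -> U) (f : U -> C) (l : list T) :
  Csum (map h l) f = Csum l (fun i => f (h i)).
Proof. induction l; simpl; congruence. Qed.

Lemma is_usum_reindex {T : Type} (A : T -> Prop) (h k : T -> T) (f : T -> C) (s : C) :
  (forall i, A i -> A (h i)) -> (forall i, A i -> A (k i)) ->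
  (forall i, A i -> k (h i) = i) -> (forall i, A i -> h (k i) = i) ->
  is_usum A f s -> is_usum A (fun i => f (h i)) s.
Proof.
intros Ah Ak kh hk Hs e.
assert (mapA : forall g : T -> T, (forall i, A i -> A (g i)) ->
  forall l, List.Forall A l -> List.Forall A (map g l)).
  intros g Ag l; rewrite Forall_map; apply Forall_impl; auto.
assert (mapN : forall g g' : T -> T, (forall i, A i -> g' (g i) = i) ->
  forall l, NoDup l -> List.Forall A l -> NoDup (map g l)).
  intros g g' Hg l Nl Fl; apply NoDup_map_NoDup_ForallPairs; auto.
  rewrite Forall_forall in Fl; intros x y Hx Hy E.
  rewrite <- (Hg x), <- (Hg y), E; auto.
destruct (Hs e) as (l0 & N0 & F0 & H0).
exists (map k l0); repeat split.
- apply mapN with h; auto.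
- auto.
- intros l Nl Fl I; rewrite <- Csum_map; apply H0.
  + apply mapN with k; auto.
  + auto.
  + intros x Hx; rewrite Forall_forall in F0.
    rewrite <- (hk x) by auto; apply in_map, I, in_map, Hx.
Qed.

Lemma summable_ext {T : Type} (A : T -> Prop) (f g : T -> C) :
  (forall i, A i -> f i = g i) -> summable A f -> summable A g.
Proof. intros E [s Hs]; exists s; apply is_usum_ext with f; auto. Qed.

Lemma usum_ext {T : Type} (A : T -> Prop) (f g : T -> C) :
  (forall i, A i -> f i = g i) -> summable A f -> usum A f = usum A g.
Proof. intros E H; symmetry; apply usum_eq, is_usum_ext with f, usum_correct; auto. Qed.

(** * Packing squares *)

Section Packing.
Local Open Scope R_scope.

Definition ind (a b x : R) : R :=
  if Rlt_dec a x then if Rlt_dec x b then 1 else 0 else 0.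

Lemma ind_01 (a b x : R) : ind a b x = 0 \/ ind a b x = 1 /\ a < x < b.
Proof. unfold ind; destruct (Rlt_dec a x); auto; destruct (Rlt_dec x b); auto. Qed.

Lemma is_RInt_ind (lo hi a b : R) :
  lo <= a -> a <= b -> b <= hi -> is_RInt (ind a b) lo hi (b - a).
Proof.
intros H1 H2 H3.
assert (Hc : forall u v k, u <= v -> (forall x, u < x < v -> ind a b x = k) ->
  is_RInt (ind a b) u v ((v - u) * k)).
  intros u v k Huv Hk; apply (is_RInt_ext (fun _ => k)).
    rewrite Rmin_left, Rmax_right by lra; intros; symmetry; auto.
  apply (is_RInt_const (V := R_NormedModule)).
replace (b - a) with (((a - lo) * 0 + (b - a) * 1) + (hi - b) * 0) by ring.
apply (is_RInt_Chasles (V := R_NormedModule)) with b.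
  apply (is_RInt_Chasles (V := R_NormedModule)) with a.
all: apply Hc; auto; intros x Hx; destruct (ind_01 a b x); try lra.
unfold ind in *; destruct (Rlt_dec a x); [|lra]; destruct (Rlt_dec x b); lra.
Qed.

Lemma is_RInt_Rsum {T : Type} (l : list T) (f : T -> R -> R) (v : T -> R) (lo hi : R) :
  (forall i, In i l -> is_RInt (f i) lo hi (v i)) ->
  is_RInt (fun x => Rsum l (fun i => f i x)) lo hi (Rsum l v).
Proof.
induction l as [|i l IH]; intros H; simpl.
  generalize (is_RInt_const (V := R_NormedModule) lo hi 0).
  unfold scal; simpl; unfold mult; simpl; rewrite Rmult_0_r; auto.
apply (is_RInt_plus (V := R_NormedModule)); [apply H; left; auto|].
apply IH; intros; apply H; right; auto.
Qed.

(** The hypothesis, integrated from [lo] to [hi]. *)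
Lemma interval_packing {T : Type} (l : list T) (c a b : T -> R) (lo hi M : R) :
  lo <= hi -> (forall i, In i l -> lo <= a i /\ a i <= b i /\ b i <= hi) ->
  (forall x, Rsum l (fun i => c i * ind (a i) (b i) x) <= M) ->
  Rsum l (fun i => c i * (b i - a i)) <= (hi - lo) * M.
Proof.
intros Hlh Hab HM.
apply (is_RInt_le (fun x => Rsum l (fun i => c i * ind (a i) (b i) x)) (fun _ => M) lo hi).
- exact Hlh.
- apply is_RInt_Rsum; intros i Hi; destruct (Hab i Hi) as (? & ? & ?).
  apply (is_RInt_scal (V := R_NormedModule)), is_RInt_ind; auto.
- apply (is_RInt_const (V := R_NormedModule)).
- intros; apply HM.
Qed.

Lemma Rsum_ext {T : Type} (f g : T -> R) (l : list T) :
  (forall i, In i l -> f i = g i) -> Rsum l f = Rsum l g.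
Proof.
induction l; intros H; simpl; auto.
rewrite IHl, H; auto; [left; auto|intros; apply H; right; auto].
Qed.

Lemma Rsum_disjoint {T : Type} (f : T -> R) (l : list T) :
  NoDup l -> (forall i, f i = 0 \/ f i = 1) ->
  (forall i j, In i l -> In j l -> f i = 1 -> f j = 1 -> i = j) -> Rsum l f <= 1.
Proof.
intros N H01; induction N as [|x l Hx N IH]; intros H; simpl; [lra|].
destruct (H01 x) as [E|E].
  rewrite E, Rplus_0_l; apply IH; intros i j Hi Hj; apply H; right; auto.
rewrite (Rsum_ext f (fun _ => 0 * 0)).
  rewrite (Rsum_scal 0 (fun _ => 0)); lra.
intros i Hi; destruct (H01 i) as [->|E']; [ring|].
destruct Hx; rewrite (H x i); simpl; auto.
Qed.

(** Disjoint squares have total area at most that of a square containing them;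
    slicing by lines reduces this to disjoint intervals, twice. *)
Lemma square_packing {T : Type} (l : list T) (x y s : T -> R) (L : R) :
  NoDup l -> 0 <= L ->
  (forall i, In i l -> 0 <= s i /\ Rabs (x i) + s i <= L /\ Rabs (y i) + s i <= L) ->
  (forall i j X Y, In i l -> In j l ->
    Rabs (X - x i) < s i -> Rabs (Y - y i) < s i ->
    Rabs (X - x j) < s j -> Rabs (Y - y j) < s j -> i = j) ->
  Rsum l (fun i => (s i)^2) <= L^2.
Proof.
intros N HL Hin Hdisj.
assert (Hbd : forall c : T -> R, (forall i, In i l -> Rabs (c i) + s i <= L) ->
  forall i, In i l -> - L <= c i - s i /\ c i - s i <= c i + s i /\ c i + s i <= L).
  intros c Hc i Hi; specialize (Hc i Hi); destruct (Hin i Hi) as [? _].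
  revert Hc; unfold Rabs; destruct (Rcase_abs (c i)); lra.
assert (Hslice : forall X,
  Rsum l (fun i => ind (x i - s i) (x i + s i) X * ((y i + s i) - (y i - s i)))
    <= (L - - L) * 1).
  intros X; apply interval_packing; try lra.
    apply Hbd; intros i Hi; apply Hin, Hi.
  intros Y; apply Rsum_disjoint; auto.
    intros i; destruct (ind_01 (x i - s i) (x i + s i) X) as [->|[-> _]];
    destruct (ind_01 (y i - s i) (y i + s i) Y) as [->|[-> _]]; lra.
  intros i j Hi Hj Ei Ej.
  destruct (ind_01 (x i - s i) (x i + s i) X) as [E|[_ Xi]]; [rewrite E in Ei; lra|].
  destruct (ind_01 (y i - s i) (y i + s i) Y) as [E|[_ Yi]]; [rewrite E in Ei; lra|].
  destruct (ind_01 (x j - s j) (x j + s j) X) as [E|[_ Xj]]; [rewrite E in Ej; lra|].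
  destruct (ind_01 (y j - s j) (y j + s j) Y) as [E|[_ Yj]]; [rewrite E in Ej; lra|].
  apply (Hdisj i j X Y); auto; apply Rabs_def1; lra.
assert (H : Rsum l (fun i => (2 * s i) * ((x i + s i) - (x i - s i)))
    <= (L - - L) * ((L - - L) * 1)).
  apply interval_packing; try lra.
    apply Hbd; intros i Hi; apply Hin, Hi.
  intros X; eapply Rle_trans; [|apply (Hslice X)]; right; apply Rsum_ext; intros; ring.
rewrite (Rsum_ext _ (fun i => 4 * (s i)^2)) in H by (intros; ring).
rewrite Rsum_scal in H; nra.
Qed.

End Packing.

(** * Automorphisms of the disk *)

Lemma disk_eq (z w : disk) : (z : C) = w -> z = w.
Proof.
destruct z as [z hz], w as [w hw]; simpl; intros ->; f_equal; apply proof_irrelevance.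
Qed.

Lemma disk_lt (z : disk) : (Cmod z < 1)%R.
Proof. exact (proj2_sig z). Qed.

Lemma Cmod_0_lt_1 : Cmod 0 < 1.
Proof. rewrite Cmod_0; lra. Qed.

Definition origin : disk := exist _ (RtoC 0) Cmod_0_lt_1.

Lemma Cmod_le_inv (x y : C) : (Cmod x - Cmod y <= Cmod (x + y))%R.
Proof.
generalize (Cmod_triangle (x + y) (- y)); rewrite Cmod_opp.
replace (x + y + - y) with x by ring; lra.
Qed.

Lemma su11_det (a b : C) :
  (Cmod a ^ 2 - Cmod b ^ 2 = 1)%R -> a * Cconj a - b * Cconj b = 1.
Proof. intros H; rewrite <- !Cmod2_conj, <- RtoC_minus, H; auto. Qed.

Lemma su11_lt (a b : C) : (Cmod a ^ 2 - Cmod b ^ 2 = 1)%R -> (Cmod b < Cmod a)%R.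
Proof. intros H; generalize (Cmod_ge_0 a) (Cmod_ge_0 b); nra. Qed.

Lemma su11_neq0 (a b : C) : (Cmod a ^ 2 - Cmod b ^ 2 = 1)%R -> Cconj a <> 0.
Proof.
intros H; apply Cmod_gt_0; rewrite Cmod_conj.
generalize (su11_lt a b H) (Cmod_ge_0 b); lra.
Qed.

Lemma su11_denom_neq0 (a b z : C) :
  (Cmod a ^ 2 - Cmod b ^ 2 = 1)%R -> (Cmod z < 1)%R -> Cconj b * z + Cconj a <> 0.
Proof.
intros H Hz; apply Cmod_gt_0; generalize (Cmod_le_inv (Cconj a) (Cconj b * z)).
rewrite Cmod_mult, !Cmod_conj, Cplus_comm.
generalize (su11_lt a b H) (Cmod_ge_0 b) (Cmod_ge_0 z); nra.
Qed.

Lemma su11_origin (a b : C) (g : disk -> disk) : su11_map a b g -> (g origin : C) = b / Cconj a.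
Proof.
intros [_ E]; rewrite E; simpl; f_equal; [|f_equal]; ring.
Qed.

(** The conformal density of [g] at the origin, [1/|a|^2] for the matrix
    [(a, b; conj b, conj a)]; every series below is dominated by its square. *)
Definition weight (g : disk -> disk) : R := (1 - Cmod (g origin) ^ 2)%R.

Lemma weight_su11 (a b : C) (g : disk -> disk) :
  su11_map a b g -> weight g = (/ Cmod a ^ 2)%R.
Proof.
intros Hg; unfold weight; rewrite (su11_origin a b g Hg); destruct Hg as [H _].
rewrite Cmod_div, Cmod_conj by (eapply su11_neq0; eauto).
generalize (su11_lt a b H) (Cmod_ge_0 b); intros.
replace 1%R with (Cmod a ^ 2 / Cmod a ^ 2)%R at 1 by (field; lra).
rewrite <- (Rmult_1_l (/ _)), <- H; field; lra.
Qed.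

Lemma weight_bounds (g : disk -> disk) : (0 < weight g <= 1)%R.
Proof.
unfold weight; destruct (g origin) as [z hz]; simpl; generalize (Cmod_ge_0 z); nra.
Qed.

(** With [eta = zeta - g 0] one has [g^-1 zeta = conj a^2 eta / (1 - conj a conj b eta)]:
    up to a factor [2], the map [g^-1] expands by [|a|^2] near [g 0]. *)
Lemma su11_ball_image (a b zeta : C) (g : disk -> disk) (r : R) :
  su11_map a b g -> (r <= 1)%R -> (Cmod (zeta - g origin) < r / 2 * weight g)%R ->
  exists u : disk, (Cmod u < r)%R /\ (g u : C) = zeta.
Proof.
intros Hg Hr Hz; rewrite (weight_su11 a b g Hg), (su11_origin a b g Hg) in Hz.
destruct Hg as [H Hg].
set (eta := zeta - b / Cconj a) in *.
generalize (su11_lt a b H) (Cmod_ge_0 b) (Cmod_ge_0 eta); intros Hab Hb He.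
assert (Ha : Cconj a <> 0) by (eapply su11_neq0; eauto).
assert (Hz' : (Cmod a ^ 2 * Cmod eta < r / 2)%R).
  apply (Rmult_lt_compat_l (Cmod a ^ 2)) in Hz; [|nra].
  replace (Cmod a ^ 2 * (r / 2 * / Cmod a ^ 2))%R with (r / 2)%R in Hz by (field; lra); lra.
set (D := 1 - Cconj a * Cconj b * eta).
assert (HD : (1 / 2 <= Cmod D)%R).
  generalize (Cmod_le_inv 1 (- (Cconj a * Cconj b * eta))).
  rewrite Cmod_1, Cmod_opp, !Cmod_mult, !Cmod_conj; unfold D, Cminus.
  assert (Cmod a * Cmod b * Cmod eta <= Cmod a ^ 2 * Cmod eta)%R
    by (apply Rmult_le_compat_r; nra).
  lra.
assert (D0 : D <> 0) by (apply Cmod_gt_0; lra).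
assert (Hu : (Cmod (Cconj a ^ 2 * eta / D) < r)%R).
  rewrite Cmod_div, Cmod_mult, Cmod_pow, Cmod_conj by auto.
  apply (Rmult_lt_reg_r (Cmod D)); [lra|].
  unfold Rdiv; rewrite Rmult_assoc, Rinv_l, Rmult_1_r by lra.
  assert (0 < r)%R by nra; nra.
assert (Hu1 : (Cmod (Cconj a ^ 2 * eta / D) < 1)%R) by lra.
exists (exist (fun z => Cmod z < 1) _ Hu1); split; [exact Hu|].
rewrite Hg; simpl.
assert (E := su11_det a b H).
assert (E1 : Cconj b * (Cconj a * (Cconj a * 1) * eta / D) + Cconj a = Cconj a / D).
  unfold D; field; exact D0.
assert (E2 : a * (Cconj a * (Cconj a * 1) * eta / D) + b = (Cconj a * eta + b) / D).
  replace (Cconj a * eta) with ((a * Cconj a - b * Cconj b) * (Cconj a * eta))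
    by (rewrite E; ring).
  unfold D; field; exact D0.
rewrite E1, E2; unfold eta; field; auto.
Qed.

(** * Disjoint images of a small disk *)

Section Group.
Variables (Gamma : (disk -> disk) -> Prop) (k : nat).
Hypothesis hGamma : uniformizes Gamma k.

Let hF : fuchsian Gamma := uniformizes_fuchsian _ _ hGamma.

Lemma proj_orbit (g : disk -> disk) (z : disk) : Gamma g -> proj Gamma (g z) = proj Gamma z.
Proof.
intros Hg.
assert (E : orbit Gamma (g z) = orbit Gamma z).
  apply functional_extensionality; intros w; apply propositional_extensionality.
  split; intros (h & Hh & ->).
    exists (fun x => h (g x)); split; auto; apply fuchsian_comp; auto.
  destruct (fuchsian_inv _ hF g Hg) as (g' & Hg' & Hl & _).
  exists (fun x => h (g' x)); split; [apply fuchsian_comp; auto|rewrite Hl; auto].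
unfold proj; generalize (ex_intro (fun z0 => orbit Gamma z = orbit Gamma z0) z eq_refl).
generalize (ex_intro (fun z0 => orbit Gamma (g z) = orbit Gamma z0) (g z) eq_refl).
rewrite E; intros; f_equal; apply proof_irrelevance.
Qed.

(** The sheet of the covering through the origin contains a disk of radius [R],
    on which points of one orbit coincide. If [h] sends a point near the origin
    to a point near the origin, then [h 0] lies in that disk, so [h] fixes [0]
    and is a rotation; then [h] fixes [R/2] too, so it is the identity. *)
Lemma deck_small_displacement :
  exists r : R, (0 < r <= 1)%R /\
    forall h u, Gamma h -> (Cmod (disk_val u) < r)%R -> (Cmod (disk_val (h u)) < r)%R ->
      forall z, h z = z.
Proof.
destruct (uniformizes_covering _ _ hGamma (proj Gamma origin))
  as (V & _ & HV & J & U & HUo & _ & HVU & HU).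
destruct (proj1 (HVU origin) HV) as [j Hj].
destruct (HU j) as [Hinj _].
destruct (HUo j (origin : C)) as [e He]; [exists Cmod_0_lt_1; exact Hj|].
set (R := Rmin e 1).
assert (HR : (0 < R <= 1)%R).
  unfold R; split; [apply Rmin_pos; [apply e|lra]|apply Rmin_r].
assert (HUR : forall z : disk, (Cmod z < R)%R -> U j z).
  intros z Hz.
  destruct (He (z : C)) as [hz Uz].
    apply (norm_compat1 (V := C_NormedModule)).
    change (Cmod (z - 0) < e); replace (z - 0) with (z : C) by ring.
    generalize (Rmin_l e 1); unfold R in Hz; lra.
  replace z with (exist (fun z => Cmod z < 1) (disk_val z) hz); auto.
  apply disk_eq; auto.
(* If [u] and [h u] have modulus below [R/4], then [|h 0| = |b|/|a|] is below [R]. *)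
exists (R / 4)%R; split; [lra|]; intros h u Gh Hu Hhu.
assert (fix_small : forall z : disk, (Cmod z < R)%R -> (Cmod (h z) < R)%R -> h z = z).
  intros z Hz Hhz; apply Hinj; auto; apply proj_orbit; auto.
destruct (fuchsian_psu11 _ hF h Gh) as (a & b & Hsu).
assert (Hsu' := Hsu); destruct Hsu as [H E].
assert (Ha : Cconj a <> 0) by (eapply su11_neq0; eauto).
generalize (su11_lt a b H) (Cmod_ge_0 b); intros Hab Hb.
assert (Hb0 : (Cmod b < R * Cmod a)%R).
  assert (Eu : b = h u * (Cconj b * u + Cconj a) + - (a * u)).
    rewrite E; field; apply su11_denom_neq0; auto; lra.
  generalize (Cmod_triangle (h u * (Cconj b * u + Cconj a)) (- (a * u))).
  rewrite <- Eu, Cmod_opp, !Cmod_mult.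
  generalize (Cmod_triangle (Cconj b * u) (Cconj a)).
  rewrite Cmod_mult, !Cmod_conj.
  generalize (Cmod_ge_0 u) (Cmod_ge_0 (h u)) (Cmod_ge_0 (Cconj b * u + Cconj a)).
  set (x := Cmod (Cconj b * u + Cconj a)); set (p := Cmod u) in *.
  set (q := Cmod (h u)) in *; intros P0 Q0 X0 T1 T2.
  assert (x <= Cmod a * (5 / 4))%R by nra.
  assert (q * x <= R / 4 * (Cmod a * (5 / 4)))%R by (apply Rmult_le_compat; lra).
  nra.
assert (h0 : h origin = origin).
  apply fix_small; [simpl; rewrite Cmod_0; lra|].
  rewrite (su11_origin a b h Hsu'), Cmod_div, Cmod_conj by auto.
  apply (Rmult_lt_reg_r (Cmod a)); [lra|].
  unfold Rdiv; rewrite Rmult_assoc, Rinv_l, Rmult_1_r by lra; lra.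
assert (b0 : b = 0).
  apply (f_equal disk_val) in h0; rewrite (su11_origin a b h Hsu') in h0; simpl in h0.
  replace b with (b / Cconj a * Cconj a) by (field; auto); rewrite h0; ring.
assert (Hrot : forall z : disk, (h z : C) = a / Cconj a * z).
  intros z; rewrite E, b0; replace (Cconj 0) with (RtoC 0).
    replace (0 * z + Cconj a) with (Cconj a) by ring; field; auto.
  unfold Cconj; simpl; rewrite Ropp_0; auto.
assert (Hv : (Cmod (RtoC (R / 2)) < R)%R) by (rewrite Cmod_R, Rabs_pos_eq; lra).
assert (Hv1 : (Cmod (RtoC (R / 2)) < 1)%R) by lra.
assert (hv := fix_small (exist (fun z => Cmod z < 1) _ Hv1) Hv).
assert (aa : a / Cconj a = 1).
  apply (f_equal disk_val) in hv.
    rewrite Hrot in hv; simpl in hv.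
    replace (a / Cconj a) with (a / Cconj a * (RtoC (R / 2)) / RtoC (R / 2)).
      rewrite hv; field; intros E0; apply RtoC_inj in E0; lra.
    field; split; auto; intros E0; apply RtoC_inj in E0; lra.
  rewrite Hrot; simpl; rewrite Cmod_mult, Cmod_div, Cmod_conj by auto.
  unfold Rdiv at 1; rewrite Rinv_r, Rmult_1_l by lra; auto.
intros z; apply disk_eq; rewrite Hrot, aa; ring.
Qed.

(** The images of a small disk about the origin are disjoint, and [g] maps it
    onto a set containing a square of side comparable to [weight g] centred at
    [g 0]; compare areas. *)
Lemma sums_bounded_weight : exists B, sums_bounded Gamma (fun g => (weight g ^ 2)%R) B.
Proof.
destruct deck_small_displacement as (r & Hr & Hdisp).
exists (64 / r ^ 2)%R; split; [intros; apply pow2_ge_0|].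
intros l [Nl Fl]; rewrite Forall_forall in Fl.
(* A square of half-side [s] lies in the disk of radius [2 s] about its centre,
   which is covered by [su11_ball_image] when [2 s = r/2 * weight g]. *)
assert (H : (Rsum l (fun g => (r / 4 * weight g) ^ 2) <= 2 ^ 2)%R).
  apply (square_packing l (fun g => Re (g origin)) (fun g => Im (g origin))); auto; [lra| |].
  - intros g _; destruct (weight_bounds g).
    generalize (Rmax_Cmod (disk_val (g origin))) (disk_lt (g origin)).
    intros H1 H2.
    assert (Rabs (Re (g origin)) <= 1)%R.
      eapply Rle_trans; [apply Rmax_l|]; eapply Rle_trans; [apply H1|lra].
    assert (Rabs (Im (g origin)) <= 1)%R.
      eapply Rle_trans; [apply Rmax_r|]; eapply Rle_trans; [apply H1|lra].
    split; [|split]; nra.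
  - intros g h X Y Hg Hh Xg Yg Xh Yh; apply Fl in Hg; apply Fl in Hh.
    assert (Hball : forall f, Gamma f ->
      (Rabs (X - Re (f origin)) < r / 4 * weight f)%R ->
      (Rabs (Y - Im (f origin)) < r / 4 * weight f)%R ->
      exists u : disk, (Cmod u < r)%R /\ (f u : C) = (X, Y)).
      intros f Gf HX HY; destruct (fuchsian_psu11 _ hF f Gf) as (a & b & Hsu).
      apply (su11_ball_image a b); auto; [lra|].
      eapply Rle_lt_trans; [apply Cmod_2Rmax|].
      assert (Hs : (sqrt 2 < 2)%R).
        rewrite <- (sqrt_Rsqr 2) at 2 by lra; apply sqrt_lt_1; unfold Rsqr; lra.
      destruct (disk_val (f origin)) as [p q]; simpl in *.
      change (X + - p)%R with (X - p)%R; change (Y + - q)%R with (Y - q)%R.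
      generalize (sqrt_pos 2) (Rmax_lub_lt _ _ _ HX HY); intros S0 HM.
      assert (0 <= Rmax (Rabs (X - p)) (Rabs (Y - q)))%R
        by (eapply Rle_trans; [apply Rabs_pos|apply Rmax_l]).
      nra.
    destruct (Hball g Hg Xg Yg) as (u & Hu & Eu).
    destruct (Hball h Hh Xh Yh) as (v & Hv & Ev).
    assert (E : g u = h v) by (apply disk_eq; congruence).
    destruct (fuchsian_inv _ hF h Hh) as (h' & Gh' & Hl & Hr').
    apply functional_extensionality; intros z.
    rewrite <- (Hr' (g z)); f_equal.
    apply (Hdisp (fun z => h' (g z)) u); auto; [apply fuchsian_comp; auto|].
    rewrite E, Hl; auto.
rewrite (Rsum_ext _ (fun g => (r / 4) ^ 2 * weight g ^ 2)%R) in H by (intros; ring).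
rewrite Rsum_scal in H.
apply (Rmult_le_reg_l ((r / 4) ^ 2)); [nra|].
replace ((r / 4) ^ 2 * (64 / r ^ 2))%R with 4%R by (field; lra); lra.
Qed.

End Group.

(** * Complex derivatives from quadratic remainders *)

Notation is_cderive f x l := (is_derive (K := C_AbsRing) (V := C_NormedModule) f x l).

Lemma is_cderive_quadratic (f : C -> C) (x l : C) (M d : R) :
  (0 < d)%R ->
  (forall y, (Cmod (y - x) < d)%R ->
    (Cmod (f y - f x - l * (y - x)) <= M * Cmod (y - x) ^ 2)%R) ->
  is_cderive f x l.
Proof.
intros Hd H; split; [apply is_linear_scal_l|].
intros x' Hx'.
apply (is_filter_lim_locally_unique (K := C_AbsRing) (V := AbsRing_NormedModule C_AbsRing)) in Hx'.
subst x'; intros eps.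
assert (HM : (0 < Rabs M + 1)%R) by (generalize (Rabs_pos M); lra).
assert (He : (0 < Rmin d (eps / (Rabs M + 1)))%R).
  apply Rmin_pos; auto; apply Rdiv_lt_0_compat; auto; apply eps.
exists (mkposreal _ He); intros y Hy.
change (Cmod (y - x) < Rmin d (eps / (Rabs M + 1)))%R in Hy.
change (Cmod (f y - f x - (y - x) * l) <= eps * Cmod (y - x))%R.
rewrite (Cmult_comm (y - x) l).
generalize (H y (Rlt_le_trans _ _ _ Hy (Rmin_l _ _))).
assert (Hy2 := Rlt_le_trans _ _ _ Hy (Rmin_r _ _)).
apply (Rmult_lt_compat_r (Rabs M + 1)) in Hy2; [|lra].
unfold Rdiv in Hy2; rewrite Rmult_assoc, Rinv_l, Rmult_1_r in Hy2 by lra.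
generalize (Cmod_ge_0 (y - x)) (Rle_abs M); set (h := Cmod (y - x)) in *; intros Hh HMM Hf.
eapply Rle_trans; [apply Hf|].
replace (M * h ^ 2)%R with (M * h * h)%R by ring.
apply Rmult_le_compat_r; nra.
Qed.

(** * Uniformly differentiable families *)

Section Tame.
Context {T : Type} (A : T -> Prop) (rho : R).

(** Bounds uniform in the index, with a quadratic remainder: the property is
    preserved by sums and products, and it survives summation against a
    summable family of coefficients. *)
Definition tame (f df : T -> C -> C) : Prop :=
  exists M, forall i x y, A i -> (Cmod x <= rho)%R -> (Cmod y <= rho)%R ->
    (Cmod (f i x) <= M)%R /\ (Cmod (df i x) <= M)%R /\
    (Cmod (f i y - f i x - df i x * (y - x)) <= M * Cmod (y - x) ^ 2)%R.

Lemma tame_ext (f df g dg : T -> C -> C) :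
  (forall i x, A i -> (Cmod x <= rho)%R -> f i x = g i x) ->
  (forall i x, A i -> (Cmod x <= rho)%R -> df i x = dg i x) ->
  tame f df -> tame g dg.
Proof.
intros E dE [M H]; exists M; intros i x y Ai Hx Hy.
rewrite <- !E, <- dE by auto; auto.
Qed.

Lemma tame_const (c : T -> C) (K : R) :
  (forall i, A i -> (Cmod (c i) <= K)%R) -> tame (fun i _ => c i) (fun _ _ => 0).
Proof.
intros H; exists K; intros i x y Ai _ _; specialize (H i Ai).
generalize (Cmod_ge_0 (c i)); intros H0.
replace (c i - c i - 0 * (y - x)) with (RtoC 0) by ring; rewrite Cmod_0.
repeat split; try lra; apply Rmult_le_pos; [lra|apply pow2_ge_0].
Qed.

Lemma tame_id : tame (fun _ x => x) (fun _ _ => 1).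
Proof.
exists (rho + 1)%R; intros i x y _ Hx Hy; generalize (Cmod_ge_0 x); intros H0.
replace (y - x - 1 * (y - x)) with (RtoC 0) by ring; rewrite Cmod_0, Cmod_1.
repeat split; try lra; apply Rmult_le_pos; [lra|apply pow2_ge_0].
Qed.

Lemma tame_plus (f df g dg : T -> C -> C) :
  tame f df -> tame g dg ->
  tame (fun i x => f i x + g i x) (fun i x => df i x + dg i x).
Proof.
intros [M H] [N G]; exists (M + N)%R; intros i x y Ai Hx Hy.
destruct (H i x y Ai Hx Hy) as (H1 & H2 & H3).
destruct (G i x y Ai Hx Hy) as (G1 & G2 & G3).
repeat split; try (eapply Rle_trans; [apply Cmod_triangle|lra]).
replace (_ - _ - _) with ((f i y - f i x - df i x * (y - x)) +
  (g i y - g i x - dg i x * (y - x))) by ring.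
eapply Rle_trans; [apply Cmod_triangle|lra].
Qed.

Lemma tame_mult (f df g dg : T -> C -> C) :
  tame f df -> tame g dg ->
  tame (fun i x => f i x * g i x) (fun i x => df i x * g i x + f i x * dg i x).
Proof.
intros [M H] [N G]; exists (M * N * (3 + 2 * rho))%R; intros i x y Ai Hx Hy.
destruct (H i x y Ai Hx Hy) as (H1 & H2 & H3).
destruct (G i x y Ai Hx Hy) as (G1 & G2 & G3).
destruct (H i y x Ai Hy Hx) as (H1y & _).
generalize (Cmod_ge_0 (f i x)) (Cmod_ge_0 (g i x)) (Cmod_ge_0 x) (Cmod_ge_0 (y - x)).
generalize (Cmod_ge_0 (df i x)) (Cmod_ge_0 (dg i x)).
intros P1 P2 P3 P4 P5 P6.
assert (MN : (0 <= M * N)%R) by (apply Rmult_le_pos; lra).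
assert (MNr : (0 <= M * N * rho)%R) by (apply Rmult_le_pos; lra).
assert (Hh : (Cmod (y - x) <= 2 * rho)%R).
  generalize (Cmod_triangle y (- x)); rewrite Cmod_opp; unfold Cminus; lra.
set (h := Cmod (y - x)) in *.
assert (Lip : (Cmod (f i y - f i x) <= M * (1 + 2 * rho) * h)%R).
  replace (f i y - f i x) with ((f i y - f i x - df i x * (y - x)) + df i x * (y - x)) by ring.
  eapply Rle_trans; [apply Cmod_triangle|].
  rewrite (Cmod_mult (df i x)); fold h.
  assert (Cmod (df i x) * h <= M * h)%R by (apply Rmult_le_compat_r; auto).
  assert (M * h ^ 2 <= M * h * (2 * rho))%R.
    replace (M * h ^ 2)%R with (M * h * h)%R by ring.
    apply Rmult_le_compat_l; auto; apply Rmult_le_pos; lra.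
  lra.
repeat split.
- rewrite Cmod_mult.
  assert (Cmod (f i x) * Cmod (g i x) <= M * N)%R by (apply Rmult_le_compat; auto).
  nra.
- eapply Rle_trans; [apply Cmod_triangle|]; rewrite !Cmod_mult.
  assert (Cmod (df i x) * Cmod (g i x) <= M * N)%R by (apply Rmult_le_compat; auto).
  assert (Cmod (f i x) * Cmod (dg i x) <= M * N)%R by (apply Rmult_le_compat; auto).
  nra.
- replace (_ - _ - _) with
    (f i y * (g i y - g i x - dg i x * (y - x)) +
     ((f i y - f i x) * (dg i x * (y - x)) +
      g i x * (f i y - f i x - df i x * (y - x)))) by ring.
  eapply Rle_trans; [apply Cmod_triangle|].
  eapply Rle_trans; [apply Rplus_le_compat_l, Cmod_triangle|].
  rewrite (Cmod_mult (f i y)), (Cmod_mult (f i y - f i x)), (Cmod_mult (dg i x)), (Cmod_mult (g i x)).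
  fold h.
  assert (Cmod (f i y) * Cmod (g i y - g i x - dg i x * (y - x)) <= M * (N * h ^ 2))%R
    by (apply Rmult_le_compat; auto using Cmod_ge_0).
  assert (Cmod (g i x) * Cmod (f i y - f i x - df i x * (y - x)) <= N * (M * h ^ 2))%R
    by (apply Rmult_le_compat; auto using Cmod_ge_0).
  assert (Cmod (f i y - f i x) * (Cmod (dg i x) * h) <= M * (1 + 2 * rho) * h * (N * h))%R.
    apply Rmult_le_compat; auto using Cmod_ge_0; [apply Rmult_le_pos; auto|].
    apply Rmult_le_compat_r; auto.
  lra.
Qed.

Lemma tame_scal (c : C) (f df : T -> C -> C) :
  tame f df -> tame (fun i x => c * f i x) (fun i x => c * df i x).
Proof.
intros H.
apply (tame_ext (fun i x => c * f i x) (fun i x => 0 * f i x + c * df i x)); auto.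
  intros; ring.
apply (tame_mult (fun _ _ => c) (fun _ _ => 0)); auto.
apply (tame_const (fun _ => c) (Cmod c)); intros; lra.
Qed.

Lemma tame_pow (f df : T -> C -> C) (n : nat) :
  tame f df ->
  tame (fun i x => f i x ^ S n) (fun i x => INR (S n) * f i x ^ n * df i x).
Proof.
intros H; induction n as [|n IH].
  apply tame_ext with f df; auto; intros; simpl; ring.
apply tame_ext with (fun i x => f i x * f i x ^ S n)
  (fun i x => df i x * f i x ^ S n + f i x * (INR (S n) * f i x ^ n * df i x)).
- auto.
- intros; rewrite (S_INR (S n)), RtoC_plus, !Cpow_S; ring.
- apply tame_mult; auto.
Qed.

Lemma tame_inv_affine (beta : T -> C) :
  (rho < 1)%R -> (forall i, A i -> (Cmod (beta i) <= 1)%R) ->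
  tame (fun i x => / (1 + beta i * x)) (fun i x => - beta i * (/ (1 + beta i * x)) ^ 2).
Proof.
intros Hr Hb; set (K := (/ (1 - rho))%R).
assert (HK : forall i x, A i -> (Cmod x <= rho)%R ->
  1 + beta i * x <> 0 /\ (Cmod (/ (1 + beta i * x)) <= K)%R).
  intros i x Ai Hx.
  assert (1 - rho <= Cmod (1 + beta i * x))%R.
    generalize (Cmod_le_inv 1 (beta i * x)) (Hb i Ai) (Cmod_ge_0 (beta i)) (Cmod_ge_0 x).
    rewrite Cmod_1, Cmod_mult; nra.
  assert (1 + beta i * x <> 0) by (apply Cmod_gt_0; lra).
  split; auto; rewrite Cmod_inv by auto; apply Rinv_le_contravar; lra.
exists (K + K ^ 2 + K ^ 3)%R; intros i x y Ai Hx Hy.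
destruct (HK i x Ai Hx) as [Nx Kx]; destruct (HK i y Ai Hy) as [Ny Ky].
assert (K0 : (0 <= K)%R) by (eapply Rle_trans; [apply Cmod_ge_0|apply Kx]).
assert (K2 : (0 <= K ^ 2)%R) by (apply pow_le; auto).
assert (K3 : (0 <= K ^ 3)%R) by (apply pow_le; auto).
specialize (Hb i Ai).
assert (Hx2 : (Cmod (/ (1 + beta i * x)) ^ 2 <= K ^ 2)%R)
  by (apply pow_incr; split; auto; apply Cmod_ge_0).
repeat split; [lra| |].
- rewrite Cmod_mult, Cmod_opp, Cmod_pow.
  generalize (pow2_ge_0 (Cmod (/ (1 + beta i * x)))) (Cmod_ge_0 (beta i)); nra.
- replace (_ - _ - _) with ((beta i * (y - x)) ^ 2 *
    ((/ (1 + beta i * x)) ^ 2 * / (1 + beta i * y))) by (field; auto).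
  rewrite !Cmod_mult, !Cmod_pow, Cmod_mult, Rpow_mult_distr.
  assert (Cmod (beta i) ^ 2 <= 1)%R
    by (replace 1%R with (1 ^ 2)%R by ring; apply pow_incr; split; auto; apply Cmod_ge_0).
  assert (Cmod (/ (1 + beta i * x)) ^ 2 * Cmod (/ (1 + beta i * y)) <= K ^ 2 * K)%R
    by (apply Rmult_le_compat; auto using Cmod_ge_0, pow2_ge_0).
  assert (Cmod (beta i) ^ 2 * Cmod (y - x) ^ 2 <= 1 * Cmod (y - x) ^ 2)%R
    by (apply Rmult_le_compat_r; auto using pow2_ge_0).
  rewrite (Rmult_comm (K + K ^ 2 + K ^ 3)).
  apply Rmult_le_compat; [| |lra|simpl in *; lra].
    apply Rmult_le_pos; apply pow2_ge_0.
  apply Rmult_le_pos; auto using Cmod_ge_0, pow2_ge_0.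
Qed.

(** ** Series *)

Context (mu : T -> R) (B : R) (c : T -> C).
Hypothesis mu_bounded : sums_bounded A mu B.
Hypothesis c_mu : forall i, A i -> (Cmod (c i) <= mu i)%R.

Lemma series_bound (f : T -> C) (M : R) :
  (forall i, A i -> (Cmod (f i) <= M)%R) ->
  summable A (fun i => c i * f i) /\
  forall s, is_usum A (fun i => c i * f i) s -> (Cmod s <= Rabs M * B)%R.
Proof.
intros HM.
assert (Hb : sums_bounded A (fun i => Rabs M * mu i)%R (Rabs M * B)%R)
  by (apply sums_bounded_scal; auto; apply Rabs_pos).
assert (H : forall i, A i -> (Cmod (c i * f i) <= Rabs M * mu i)%R).
  intros i Ai; rewrite Cmod_mult, Rmult_comm.
  apply Rmult_le_compat; auto using Cmod_ge_0.
  eapply Rle_trans; [apply HM; auto|apply Rle_abs].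
split; [eapply summable_dominated; eauto|].
intros s; eapply is_usum_bound; eauto.
Qed.

Lemma summable_series (f df : T -> C -> C) (x : C) :
  tame f df -> (Cmod x <= rho)%R ->
  summable A (fun i => c i * f i x) /\ summable A (fun i => c i * df i x).
Proof.
intros [M H] Hx; split; apply (series_bound _ M); intros i Ai; apply (H i x x); auto.
Qed.

(** The quadratic remainders of the terms add up to one for the sum, so the
    series is differentiated term by term. *)
Lemma is_cderive_series (f df : T -> C -> C) (x : C) :
  tame f df -> (Cmod x < rho)%R ->
  is_cderive (fun y => usum A (fun i => c i * f i y)) x (usum A (fun i => c i * df i x)).
Proof.
intros Ht Hx; destruct (Ht) as [M H].
apply (is_cderive_quadratic _ _ _ (Rabs M * B) (rho - Cmod x)); [lra|].
intros y Hy.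
assert (Hy' : (Cmod y <= rho)%R).
  generalize (Cmod_triangle x (y - x)); replace (x + (y - x)) with y by ring; lra.
destruct (summable_series f df x Ht (Rlt_le _ _ Hx)) as [Sx Sdx].
destruct (summable_series f df y Ht Hy') as [Sy _].
apply usum_correct in Sx; apply usum_correct in Sdx; apply usum_correct in Sy.
assert (S := is_usum_minus _ _ _ _ _ (is_usum_minus _ _ _ _ _ Sy Sx)
  (is_usum_scal _ (y - x) _ _ Sdx)).
rewrite (Cmult_comm (usum A (fun i => c i * df i x))).
set (s := _ - _ - _) in *.
destruct (Req_dec (Cmod (y - x)) 0) as [E|E].
  assert (yx : y = x).
    apply Cmod_eq_0 in E; replace y with (y - x + x) by ring; rewrite E; ring.
  unfold s; subst y.
  replace (_ - _ - _) with (RtoC 0) by ring; rewrite Cmod_0, E; lra.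
assert (E' : (0 < Cmod (y - x) ^ 2)%R).
  apply pow_lt; generalize (Cmod_ge_0 (y - x)); lra.
set (h2 := (Cmod (y - x) ^ 2)%R) in *.
assert (h2' : RtoC h2 <> 0) by (intros F; apply RtoC_inj in F; lra).
assert (S' := is_usum_scal _ (/ h2) _ _ S).
(* [series_bound] is applied to the remainders divided by [|y - x|^2]. *)
assert (Q : (Cmod (/ h2 * s) <= Rabs M * B)%R).
  apply (series_bound (fun i => / h2 * (f i y - f i x - df i x * (y - x))) M).
    intros i Ai; destruct (H i x y Ai) as (_ & _ & H3); try lra.
    rewrite Cmod_mult, Cmod_inv, Cmod_R, Rabs_pos_eq by (auto; lra).
    apply (Rmult_le_reg_l h2); [lra|].
    rewrite <- Rmult_assoc, Rinv_r, Rmult_1_l, (Rmult_comm h2) by lra; exact H3.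
  eapply is_usum_ext; [|exact S']; intros; simpl; ring.
rewrite Cmod_mult, Cmod_inv, Cmod_R, Rabs_pos_eq in Q by (auto; lra).
apply (Rmult_le_compat_l h2) in Q; [|lra].
rewrite <- Rmult_assoc, Rinv_r, Rmult_1_l in Q by lra; lra.
Qed.

End Tame.

(** * The incomplete beta integral *)

(** The primitive of [s^m (1-s)^n] that vanishes at [0]; the recursion comes
    from [s^m (1-s)^(n+1) = s^m (1-s)^n - s^(m+1) (1-s)^n]. *)
Fixpoint incomplete_beta (m n : nat) (s : C) : C :=
  match n with
  | O => / INR (S m) * s ^ S m
  | S n => incomplete_beta m n s - incomplete_beta (S m) n s
  end.

Lemma INR_S_neq0 (m : nat) : RtoC (INR (S m)) <> 0.
Proof. intros E; apply RtoC_inj in E; revert E; apply not_0_INR; lia. Qed.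

Lemma tame_incomplete_beta {T : Type} (A : T -> Prop) (rho : R) (f df : T -> C -> C) (m n : nat) :
  tame A rho f df ->
  tame A rho (fun i x => incomplete_beta m n (f i x))
    (fun i x => f i x ^ m * (1 - f i x) ^ n * df i x).
Proof.
intros H; revert m; induction n as [|n IH]; intros m.
- apply (tame_ext A rho (fun i x => / INR (S m) * f i x ^ S m)
    (fun i x => / INR (S m) * (INR (S m) * f i x ^ m * df i x))).
  + auto.
  + intros; change ((1 - f i x) ^ 0) with (RtoC 1); field; apply INR_S_neq0.
  + apply tame_scal, tame_pow, H.
- apply (tame_ext A rho
    (fun i x => incomplete_beta m n (f i x) + - (1) * incomplete_beta (S m) n (f i x))
    (fun i x => f i x ^ m * (1 - f i x) ^ n * df i x
       + - (1) * (f i x ^ S m * (1 - f i x) ^ n * df i x))).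
  + intros; simpl; ring.
  + intros; rewrite !Cpow_S; ring.
  + apply tame_plus; [apply IH|apply tame_scal, IH].
Qed.

Lemma incomplete_beta_0 (m n : nat) : incomplete_beta m n 0 = 0.
Proof.
revert m; induction n as [|n IH]; intros m; simpl; [ring|rewrite !IH; ring].
Qed.

Lemma incomplete_beta_1 (m n : nat) : exists r : R,
  is_RInt (fun t => t ^ m * (1 - t) ^ n)%R 0 1 r /\ incomplete_beta m n 1 = r.
Proof.
revert m; induction n as [|n IH]; intros m.
- exists (1 ^ S m / INR (S m) - 0 ^ S m / INR (S m))%R; split.
    eapply is_RInt_ext; [|apply is_RInt_pow]; intros; simpl; ring.
  assert (INR (S m) <> 0)%R by (apply not_0_INR; lia).
  rewrite pow1, pow_ne_zero by lia.
  change (/ INR (S m) * 1 ^ S m = RtoC (1 / INR (S m) - 0 / INR (S m))).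
  rewrite Cpow_1_l, RtoC_minus, !RtoC_div by auto.
  field; apply INR_S_neq0.
- destruct (IH m) as (r1 & I1 & E1); destruct (IH (S m)) as (r2 & I2 & E2).
  exists (r1 - r2)%R; split; [|simpl; rewrite E1, E2, RtoC_minus; auto].
  eapply is_RInt_ext; [|apply (is_RInt_minus (V := R_NormedModule)); eauto].
  intros; unfold minus, plus, opp; simpl; ring.
Qed.

Lemma incomplete_beta_Beta (n : nat) : incomplete_beta n n 1 = Beta (S n) (S n).
Proof.
destruct (incomplete_beta_1 n n) as (r & I & ->).
unfold Beta; simpl; rewrite !Nat.sub_0_r; f_equal; symmetry; apply is_RInt_unique, I.
Qed.

Lemma Beta_pos (n : nat) : (0 < Beta (S n) (S n))%R.
Proof.
unfold Beta; simpl; rewrite !Nat.sub_0_r; apply RInt_gt_0; [lra| |].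
  intros; apply Rmult_lt_0_compat; apply pow_lt; lra.
intros x _; apply (ex_derive_continuous (V := R_NormedModule)); auto_derive; auto.
Qed.

(** * Path integrals of derivatives *)

(** A complex differential is also a real one, since both module structures put
    the same norm on [C]; the chain rule over the reals then applies. *)
Lemma is_derive_comp_path (F : C -> C) (p : R -> C) (t : R) (f v : C) :
  is_cderive F (p t) f ->
  is_derive (K := R_AbsRing) (V := C_R_NormedModule) p t v ->
  is_derive (K := R_AbsRing) (V := C_R_NormedModule) (fun s => F (p s)) t (f * v).
Proof.
intros [_ HF] Hp.
assert (HFR : filterdiff (K := R_AbsRing) (U := C_R_NormedModule) (V := C_R_NormedModule)
    F (locally (p t)) (fun h => h * f)).
  split.
    split.
    - intros x y; apply Cmult_plus_distr_r.
    - intros k x; rewrite !scal_R_Cmult; symmetry; apply Cmult_assoc.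
    - exists (Cmod f + 1)%R; split; [generalize (Cmod_ge_0 f); lra|].
      intros x; rewrite <- !Cmod_norm, Cmod_mult, Rmult_comm.
      apply Rmult_le_compat_r; [apply Cmod_ge_0|lra].
  intros x Hx e.
  apply (is_filter_lim_locally_unique (V := C_R_NormedModule)) in Hx; subst x.
  assert (L : is_filter_lim (T := AbsRing_UniformSpace C_AbsRing)
    (locally (T := AbsRing_UniformSpace C_AbsRing) (p t)) (p t)) by (intros P; auto).
  specialize (HF (p t) L e); apply (locally_C (p t)) in HF.
  revert HF; apply filter_imp; intros x Hx; rewrite <- !Cmod_norm; exact Hx.
eapply filterdiff_ext_lin; [exact (filterdiff_comp' _ _ _ _ _ Hp HFR)|].
intros y; simpl; rewrite !scal_R_Cmult; ring.
Qed.

Lemma path_deriv_eq (p : R -> C) (t : R) (v : C) :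
  is_derive (K := R_AbsRing) (V := C_R_NormedModule) p t v -> path_deriv p t = v.
Proof.
intros H; destruct v as [v1 v2]; unfold path_deriv; f_equal; apply is_derive_unique.
- eapply filterdiff_ext_lin; [exact (filterdiff_comp' p (fst : C_R_NormedModule -> R_NormedModule) t _ _ H
    (filterdiff_linear _ (is_linear_fst (U := R_NormedModule) (V := R_NormedModule))))|].
  intros y; reflexivity.
- eapply filterdiff_ext_lin; [exact (filterdiff_comp' p (snd : C_R_NormedModule -> R_NormedModule) t _ _ H
    (filterdiff_linear _ (is_linear_snd (U := R_NormedModule) (V := R_NormedModule))))|].
  intros y; reflexivity.
Qed.

Lemma continuous_Cmult {U : UniformSpace} (f g : U -> C_UniformSpace) (x : U) :
  continuous f x -> continuous g x -> continuous (fun y => f y * g y : C_UniformSpace) x.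
Proof.
intros Hf Hg; apply (continuous_scal (K := C_AbsRing) (V := C_NormedModule)); auto.
intros P HP; apply Hf, locally_C, HP.
Qed.

Lemma continuous_is_cderive (f : C -> C) (x l : C) :
  is_cderive f x l -> continuous (f : C_UniformSpace -> C_UniformSpace) x.
Proof.
intros H P HP; apply locally_C.
exact (ex_derive_continuous (K := C_AbsRing) (V := C_NormedModule) f x (ex_intro _ l H) P HP).
Qed.

Lemma piecewise_C1_lt (p : R -> C) (a b : R) : piecewise_C1 p a b -> (a < b)%R.
Proof. induction 1; lra. Qed.

(** The fundamental theorem of calculus on each smooth piece; there the path is
    replaced by its smooth extension, which has the same values and, inside the
    piece, the same derivative. *)
Lemma is_RInt_path (F f : C -> C) (p : R -> C) (a b : R) :
  (forall z, (Cmod z < 1)%R -> is_cderive F z (f z)) ->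
  (forall z, (Cmod z < 1)%R -> continuous (f : C_UniformSpace -> C_UniformSpace) z) ->
  piecewise_C1 p a b -> (forall t, (a <= t <= b)%R -> (Cmod (p t) < 1)%R) ->
  is_RInt (V := C_R_NormedModule) (fun t => f (p t) * path_deriv p t) a b (F (p b) - F (p a)).
Proof.
intros HF Hf Hp; induction Hp as [a b ab (q & dq & Hq & Hdq & E)|a b c Hp1 IH1 Hp2 IH2]; intros Hd.
- rewrite !E by lra.
  assert (Hqd : forall t, (a <= t <= b)%R -> (Cmod (q t) < 1)%R)
    by (intros t Ht; rewrite <- E by auto; auto).
  apply (is_RInt_ext (V := C_R_NormedModule) (fun t => f (q t) * dq t)).
    rewrite Rmin_left, Rmax_right by lra; intros t Ht.
    rewrite E by lra; f_equal; symmetry; apply path_deriv_eq.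
    apply is_derive_ext_loc with q; auto.
    apply (filter_imp (fun s => a < s /\ s < b)); [intros s Hs; symmetry; apply E; lra|].
    apply (open_and _ _ (open_gt a) (open_lt b)); auto.
  apply (is_RInt_derive (V := C_R_CompleteNormedModule) (fun t => F (q t))).
    rewrite Rmin_left, Rmax_right by lra; intros t Ht; apply is_derive_comp_path; auto.
  rewrite Rmin_left, Rmax_right by lra; intros t Ht.
  apply (continuous_Cmult (fun t => f (q t))); [|apply Hdq].
  apply (continuous_comp q (f : C_UniformSpace -> C_UniformSpace)); auto.
  apply (ex_derive_continuous (V := C_R_NormedModule)); exists (dq t); auto.
- apply piecewise_C1_lt in Hp1, Hp2.
  replace (F (p c) - F (p a)) with ((F (p b) - F (p a)) + (F (p c) - F (p b))) by ring.
  apply (is_RInt_Chasles (V := C_R_NormedModule)) with b.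
    apply IH1; intros t Ht; apply Hd; lra.
  apply IH2; intros t Ht; apply Hd; lra.
Qed.

(** * Derivatives of automorphisms *)

Lemma ext_disk (f : disk -> C) (z : disk) : ext f z = f z.
Proof.
unfold ext; destruct (Rlt_dec (Cmod z) 1) as [h|h]; [|destruct h; exact (disk_lt z)].
f_equal; apply disk_eq; auto.
Qed.

Lemma ext_eq (f : disk -> C) (z : C) (h : Cmod z < 1) : ext f z = f (exist (fun z => Cmod z < 1) z h).
Proof. exact (ext_disk f (exist (fun z => Cmod z < 1) z h)). Qed.

Lemma is_cderive_su11 (a b : C) (g : disk -> disk) (z : disk) :
  su11_map a b g ->
  is_cderive (ext (fun x => g x : C)) (disk_val z) ((/ (Cconj b * z + Cconj a)) ^ 2).
Proof.
intros [H E].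
set (q := fun x : C => Cconj b * x + Cconj a).
assert (q0 : forall x : disk, q x <> 0)
  by (intros x; apply su11_denom_neq0; auto; exact (disk_lt x)).
assert (Hz : (Cmod z < 1)%R) by exact (disk_lt z).
set (m := (Cmod a - Cmod b)%R).
assert (Hm : (0 < m)%R) by (generalize (su11_lt a b H); unfold m; lra).
apply (is_cderive_quadratic _ _ _ (Cmod b * Cmod (/ q z) ^ 2 * / m) (1 - Cmod z)); [lra|].
intros y Hy.
assert (Hy1 : (Cmod y < 1)%R).
  generalize (Cmod_triangle z (y - z)); replace (z + (y - z)) with y by ring; lra.
revert Hy; replace y with (disk_val (exist (fun z => Cmod z < 1) y Hy1)) by auto.
generalize (exist (fun z => Cmod z < 1) y Hy1 : disk); intros y' _; clear y Hy1.
rewrite !ext_disk, !E.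
fold (q (disk_val y')) (q (disk_val z)).
assert (D := su11_det a b H).
assert (R0 : (a * y' + b) / q y' - (a * z + b) / q z = (y' - z) / (q y' * q z)).
  replace (y' - z) with ((a * Cconj a - b * Cconj b) * (y' - z)) by (rewrite D; ring).
  generalize (q0 y') (q0 z); unfold q; intros; field; auto.
rewrite R0.
replace (_ - _) with (- Cconj b * (y' - z) ^ 2 * ((/ q z) ^ 2 * / q y')).
2: { generalize (q0 y') (q0 z); intros; unfold Cdiv. 
     replace (- Cconj b * (y' - z) ^ 2) with ((q z - q y') * (y' - z)) by (unfold q; ring).
     field; auto. }
rewrite !Cmod_mult, Cmod_opp, !Cmod_pow, Cmod_conj.
assert (Hq : (Cmod (/ q y') <= / m)%R).
  rewrite Cmod_inv by auto; apply Rinv_le_contravar; auto.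
  generalize (Cmod_le_inv (Cconj a) (Cconj b * y')).
  rewrite Cmod_mult, !Cmod_conj, Cplus_comm; fold (q y').
  generalize (Cmod_ge_0 b) (Cmod_ge_0 y') (disk_lt y'); unfold m; intros; nra.
generalize (Cmod_ge_0 b) (pow2_ge_0 (Cmod (/ q z))) (pow2_ge_0 (Cmod (y' - z))).
intros P1 P2 P3.
assert (Cmod (/ q z) ^ 2 * Cmod (/ q y') <= Cmod (/ q z) ^ 2 * / m)%R
  by (apply Rmult_le_compat_l; auto).
assert (0 <= Cmod b * Cmod (y' - z) ^ 2)%R by (apply Rmult_le_pos; auto).
nra.
Qed.

Lemma deriv_su11 (a b : C) (g : disk -> disk) (z : disk) :
  su11_map a b g -> deriv g z = (/ (Cconj b * z + Cconj a)) ^ 2.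
Proof. intros H; apply is_C_derive_unique, is_cderive_su11, H. Qed.

Lemma su11_sub (a b : C) (g : disk -> disk) (z w : disk) :
  su11_map a b g ->
  g w - g z = (w - z) * / (Cconj b * w + Cconj a) * / (Cconj b * z + Cconj a).
Proof.
intros [H E]; rewrite !E.
assert (Hz := su11_denom_neq0 a b z H (disk_lt z)).
assert (Hw := su11_denom_neq0 a b w H (disk_lt w)).
replace (w - z) with ((a * Cconj a - b * Cconj b) * (w - z)) by (rewrite (su11_det a b H); ring).
field; auto.
Qed.

Lemma locally_disk (z : disk) :
  locally (T := AbsRing_UniformSpace C_AbsRing) (disk_val z) (fun y => Cmod y < 1).
Proof.
assert (H : (0 < 1 - Cmod z)%R) by (generalize (disk_lt z); lra).
exists (mkposreal _ H); intros y Hy; change C in y.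
change (Cmod (y - z) < 1 - Cmod z)%R in Hy.
generalize (Cmod_triangle z (y - z)); replace (z + (y - z)) with y by ring; lra.
Qed.

Lemma deriv_comp_su11 (a b c d : C) (g h : disk -> disk) (z : disk) :
  su11_map a b g -> su11_map c d h ->
  deriv (fun x => h (g x)) z = deriv h (g z) * deriv g z.
Proof.
intros Hg Hh; apply is_C_derive_unique.
assert (Dg := is_cderive_su11 a b g z Hg).
assert (Dh := is_cderive_su11 c d h (g z) Hh).
rewrite <- (deriv_su11 a b g z Hg) in Dg; rewrite <- (deriv_su11 c d h (g z) Hh) in Dh.
rewrite <- (ext_disk (fun x => g x : C) z) in Dh.
rewrite Cmult_comm.
apply (is_derive_ext_loc (K := C_AbsRing) (V := C_NormedModule)
  (fun x => ext (fun y => h y : C) (ext (fun y => g y : C) x))).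
  generalize (locally_disk z); apply filter_imp; intros y Hy.
  rewrite !(ext_eq _ y Hy), ext_disk; auto.
apply (is_derive_comp (K := C_AbsRing) (V := C_NormedModule)); [exact Dh|].
split; [apply is_linear_scal_l|exact (proj2 Dg)].
Qed.

(** * The Poincare series of the group *)

Lemma su11_choice (Gamma : (disk -> disk) -> Prop) :
  fuchsian Gamma -> exists ca cb : (disk -> disk) -> C,
    forall g, Gamma g -> su11_map (ca g) (cb g) g.
Proof.
intros hF.
set (ca := fun g => epsilon (inhabits (RtoC 0)) (fun a => exists b, su11_map a b g)).
exists ca, (fun g => epsilon (inhabits (RtoC 0)) (fun b => su11_map (ca g) b g)).
intros g Hg; apply (epsilon_spec (inhabits (RtoC 0)) (fun b => su11_map (ca g) b g)).
exact (epsilon_spec (inhabits (RtoC 0)) (fun a => exists b, su11_map a b g)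
  (fuchsian_psu11 _ hF g Hg)).
Qed.

Section Series.
Variables (Gamma : (disk -> disk) -> Prop) (N : nat) (ca cb : (disk -> disk) -> C) (B : R).
Hypothesis hF : fuchsian Gamma.
Hypothesis hN : (2 <= N)%nat.
Hypothesis hab : forall g, Gamma g -> su11_map (ca g) (cb g) g.
Hypothesis hB : sums_bounded Gamma (fun g => (weight g ^ 2)%R) B.

Definition ratio (g : disk -> disk) : C := Cconj (cb g) / Cconj (ca g).

(** [jac g ^ 2] is [deriv g] divided by its value at the origin: the decay in
    [g] is split off, and what remains is bounded, together with its derivative,
    uniformly in [g] on compact subsets. *)
Definition jac (g : disk -> disk) (tau : C) : C := / (1 + ratio g * tau).

Lemma ca_neq0 (g : disk -> disk) : Gamma g -> Cconj (ca g) <> 0.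
Proof. intros Hg; destruct (hab g Hg) as [H _]; eapply su11_neq0, H. Qed.

Lemma denom_ratio (g : disk -> disk) (tau : C) : Gamma g ->
  Cconj (cb g) * tau + Cconj (ca g) = Cconj (ca g) * (1 + ratio g * tau).
Proof. intros Hg; unfold ratio; field; apply ca_neq0, Hg. Qed.

Lemma Cmod_ratio (g : disk -> disk) : Gamma g -> (Cmod (ratio g) <= 1)%R.
Proof.
intros Hg; unfold ratio; rewrite Cmod_div, !Cmod_conj by (apply ca_neq0, Hg).
destruct (hab g Hg) as [H _]; apply su11_lt in H; generalize (Cmod_ge_0 (cb g)); intros H0.
apply (Rmult_le_reg_r (Cmod (ca g))); [lra|].
unfold Rdiv; rewrite Rmult_assoc, Rinv_l by lra; lra.
Qed.

Lemma one_ratio_neq0 (g : disk -> disk) (tau : disk) : Gamma g -> 1 + ratio g * tau <> 0.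
Proof.
intros Hg E; destruct (hab g Hg) as [H _].
apply (su11_denom_neq0 _ _ tau H (disk_lt tau)); rewrite denom_ratio, E by auto; ring.
Qed.

Lemma deriv_jac (g : disk -> disk) (tau : disk) : Gamma g ->
  deriv g tau = (/ Cconj (ca g)) ^ 2 * jac g tau ^ 2.
Proof.
intros Hg; rewrite (deriv_su11 _ _ g tau (hab g Hg)), denom_ratio by auto.
unfold jac; field; split; [apply one_ratio_neq0|apply ca_neq0]; auto.
Qed.

Lemma Cmod_inv_ca (g : disk -> disk) : Gamma g -> (Cmod ((/ Cconj (ca g)) ^ 2) = weight g)%R.
Proof.
intros Hg; rewrite Cmod_pow, Cmod_inv, Cmod_conj, (weight_su11 _ _ g (hab g Hg)) by (apply ca_neq0, Hg).
apply pow_inv.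
Qed.

Lemma weight_pow (g : disk -> disk) : (weight g ^ N <= weight g ^ 2)%R.
Proof.
destruct (weight_bounds g); destruct N as [|[|n]]; try lia.
replace (S (S n)) with (2 + n)%nat by lia; rewrite pow_add.
assert (weight g ^ n <= 1)%R by (rewrite <- (pow1 n); apply pow_incr; lra).
generalize (pow2_ge_0 (weight g)); nra.
Qed.

Lemma tame_jac (rho : R) : (rho < 1)%R ->
  tame Gamma rho jac (fun g x => - ratio g * jac g x ^ 2).
Proof. intros Hr; apply tame_inv_affine; auto using Cmod_ratio. Qed.

Lemma disk_radius (z : C) : (Cmod z < 1)%R -> exists rho, (Cmod z < rho < 1)%R.
Proof. intros H; exists ((Cmod z + 1) / 2)%R; lra. Qed.

(** ** Convergence, holomorphy and invariance *)

Definition coef (g : disk -> disk) : C := ((/ Cconj (ca g)) ^ 2) ^ N.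

Lemma Cmod_coef (g : disk -> disk) : Gamma g -> (Cmod (coef g) <= weight g ^ 2)%R.
Proof.
intros Hg; unfold coef; rewrite Cmod_pow, Cmod_inv_ca by auto; apply weight_pow.
Qed.

Lemma deriv_pow_coef (g : disk -> disk) (tau : disk) : Gamma g ->
  coef g * (jac g tau ^ 2) ^ N = deriv g tau ^ N.
Proof. intros Hg; rewrite deriv_jac, Cpow_mult_l by auto; reflexivity. Qed.

Lemma tame_jac_pow (rho : R) : (rho < 1)%R ->
  exists df, tame Gamma rho (fun g x => (jac g x ^ 2) ^ N) df.
Proof.
intros Hr; destruct N as [|n]; [lia|]; eexists.
apply tame_pow, tame_pow, tame_jac, Hr.
Qed.

Lemma summable_deriv_pow (tau : disk) : summable Gamma (fun g => deriv g tau ^ N).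
Proof.
destruct (disk_radius tau (disk_lt tau)) as [rho [H1 H2]].
destruct (tame_jac_pow rho H2) as [df Hdf].
apply summable_ext with (fun g => coef g * (jac g tau ^ 2) ^ N); [intros; apply deriv_pow_coef; auto|].
exact (proj1 (summable_series Gamma rho _ B coef hB Cmod_coef _ _ _ Hdf (Rlt_le _ _ H1))).
Qed.

Lemma holomorphic_poincare : holomorphic (poincare Gamma N).
Proof.
intros z; destruct (disk_radius z (disk_lt z)) as [rho [H1 H2]].
destruct (tame_jac_pow rho H2) as [df Hdf].
eexists; eapply is_derive_ext_loc.
2: exact (is_cderive_series Gamma rho _ B coef hB Cmod_coef _ _ z Hdf H1).
generalize (locally_disk z); apply filter_imp; intros y Hy.
rewrite (ext_eq _ y Hy); unfold poincare; symmetry.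
apply usum_ext; [|apply summable_deriv_pow].
intros g Hg; rewrite <- deriv_pow_coef by auto; reflexivity.
Qed.

(** By the chain rule the [h]-term at [g z], times [g'(z)^N], is the [h g]-term at
    [z]; right translation by [g] permutes the group. *)
Lemma poincare_invariant (g : disk -> disk) (z : disk) : Gamma g ->
  poincare Gamma N (g z) * deriv g z ^ N = poincare Gamma N z.
Proof.
intros Hg; destruct (fuchsian_inv _ hF g Hg) as (g' & Hg' & Hl & Hr).
assert (H : is_usum Gamma (fun h => deriv (fun x => h (g x)) z ^ N) (poincare Gamma N z)).
  apply (is_usum_reindex Gamma (fun h x => h (g x)) (fun h x => h (g' x))
    (fun h => deriv h z ^ N)).
  - intros h Hh; apply fuchsian_comp; auto.
  - intros h Hh; apply fuchsian_comp; auto.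
  - intros h _; apply functional_extensionality; intros x; rewrite Hr; auto.
  - intros h _; apply functional_extensionality; intros x; rewrite Hl; auto.
  - apply usum_correct, summable_deriv_pow.
symmetry; eapply is_usum_unique; [exact H|].
rewrite Cmult_comm.
apply is_usum_ext with (fun h => deriv g z ^ N * deriv h (g z) ^ N).
  intros h Hh; rewrite (deriv_comp_su11 _ _ _ _ g h z (hab g Hg) (hab h Hh)).
  rewrite Cpow_mult_l; ring.
apply is_usum_scal, usum_correct, summable_deriv_pow.
Qed.

(** ** Termwise primitives *)

Variables z w : disk.

Lemma sub_jac (g : disk -> disk) : Gamma g ->
  g w - g z = (/ Cconj (ca g)) ^ 2 * ((w - z) * jac g w * jac g z).
Proof.
intros Hg; rewrite (su11_sub _ _ g z w (hab g Hg)), !denom_ratio by auto.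
unfold jac; field; repeat split; try apply one_ratio_neq0; try apply ca_neq0; auto.
Qed.

Lemma Cmod_sub_pow : exists K, (0 <= K)%R /\ forall g, Gamma g ->
  (Cmod ((g w - g z) ^ N) <= K * weight g ^ 2)%R.
Proof.
assert (Hj : forall tau : disk, exists M, forall g, Gamma g -> (Cmod (jac g tau) <= M)%R).
  intros tau; destruct (disk_radius tau (disk_lt tau)) as [rho [H1 H2]].
  destruct (tame_jac rho H2) as [M HM]; exists M; intros g Hg.
  apply (HM g tau tau Hg); lra.
destruct (Hj z) as [Mz Hz]; destruct (Hj w) as [Mw Hw].
exists ((Cmod (w - z) * Rabs Mw * Rabs Mz) ^ N)%R; split.
  apply pow_le; repeat apply Rmult_le_pos; auto using Cmod_ge_0, Rabs_pos.
intros g Hg; rewrite sub_jac, Cpow_mult_l, Cmod_mult by auto.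
rewrite !Cmod_pow, <- Cmod_pow, Cmod_inv_ca, Rmult_comm by auto.
apply Rmult_le_compat; try apply weight_pow.
- apply pow_le, Cmod_ge_0.
- apply pow_le, Rlt_le, weight_bounds.
- apply pow_incr; split; [apply Cmod_ge_0|]; rewrite !Cmod_mult.
  specialize (Hz g Hg); specialize (Hw g Hg).
  generalize (Rle_abs Mz) (Rle_abs Mw); intros.
  repeat apply Rmult_le_compat; auto using Cmod_ge_0, Rmult_le_pos; lra.
Qed.

Lemma summable_sub_pow : summable Gamma (fun g => (g w - g z) ^ N).
Proof.
destruct Cmod_sub_pow as (K & K0 & HK).
exact (summable_dominated Gamma _ _ _ (sums_bounded_scal _ K B _ K0 hB) HK).
Qed.

Hypothesis zw : (w : C) - z <> 0.

Definition kernel (tau : C) : C := (w - tau) * (tau - z) / (w - z).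

(** [(g tau - g z) / (g w - g z)], in a form that makes sense for all [tau]. *)
Definition position (g : disk -> disk) (tau : C) : C :=
  (1 + ratio g * w) / (w - z) * ((tau - z) * jac g tau).

Definition dposition (g : disk -> disk) (tau : C) : C :=
  (1 + ratio g * w) * (1 + ratio g * z) / (w - z) * jac g tau ^ 2.

Lemma tame_position (rho : R) : (rho < 1)%R -> tame Gamma rho position dposition.
Proof.
intros Hr; unfold position.
apply (tame_ext Gamma rho
  (fun g x => (1 + ratio g * w) / (w - z) * ((x + - z) * jac g x))
  (fun g x => 0 * ((x + - z) * jac g x) + (1 + ratio g * w) / (w - z) *
     ((1 + 0) * jac g x + (x + - z) * (- ratio g * jac g x ^ 2)))).
- auto.
- intros g x Hg Hx; unfold dposition, jac; field; split; auto.
  assert (Hx1 : (Cmod x < 1)%R) by lra.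
  exact (one_ratio_neq0 g (exist (fun z => Cmod z < 1) x Hx1) Hg).
- apply tame_mult.
    apply tame_const with (2 * Cmod (/ (w - z)))%R; intros g Hg; unfold Cdiv.
    rewrite Cmod_mult; apply Rmult_le_compat_r; [apply Cmod_ge_0|].
    eapply Rle_trans; [apply Cmod_triangle|]; rewrite Cmod_1, Cmod_mult.
    generalize (Cmod_ratio g Hg) (disk_lt w) (Cmod_ge_0 (ratio g)) (Cmod_ge_0 w); nra.
  apply tame_mult; [|apply tame_jac, Hr].
  apply tame_plus; [apply tame_id|apply tame_const with (Cmod (- z)); intros; lra].
Qed.

(** The classical identity
    [(gw - gt) (gt - gz) / (gw - gz) = (w - t) (t - z) / (w - z) * g'(t)]:
    the substitution [s = position g t] turns the integrand into
    [(gw - gz)^N s^(N-1) (1-s)^(N-1) ds]. *)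
Lemma substitution (n : nat) (g : disk -> disk) (tau : disk) : Gamma g ->
  (g w - g z) ^ S n * (position g tau ^ n * (1 - position g tau) ^ n * dposition g tau) =
  kernel tau ^ n * deriv g tau ^ S n.
Proof.
intros Hg.
assert (Nt := one_ratio_neq0 g tau Hg); assert (Nz := one_ratio_neq0 g z Hg).
assert (Nw := one_ratio_neq0 g w Hg); assert (Na := ca_neq0 g Hg).
rewrite <- Cpow_mult_l.
replace (position g tau * (1 - position g tau)) with (kernel tau * dposition g tau)
  by (unfold position, dposition, kernel, jac; field; auto).
replace (deriv g tau) with ((g w - g z) * dposition g tau).
  rewrite !Cpow_mult_l, !Cpow_S; ring.
rewrite sub_jac, deriv_jac by auto; unfold dposition, jac; field; auto.
Qed.

Lemma position_z (g : disk -> disk) : position g z = 0.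
Proof. unfold position; replace ((z : C) - z) with (RtoC 0) by ring; ring. Qed.

Lemma position_w (g : disk -> disk) : Gamma g -> position g w = 1.
Proof.
intros Hg; unfold position, jac; field; split; auto; apply one_ratio_neq0, Hg.
Qed.

Definition primitive (n : nat) (tau : C) : C :=
  usum Gamma (fun g => (g w - g z) ^ N * incomplete_beta n n (position g tau)).

Lemma tame_primitive (n : nat) (rho : R) : (rho < 1)%R ->
  tame Gamma rho (fun g x => incomplete_beta n n (position g x))
    (fun g x => position g x ^ n * (1 - position g x) ^ n * dposition g x).
Proof. intros; apply tame_incomplete_beta, tame_position; auto. Qed.

Lemma is_cderive_primitive (n : nat) (tau : C) : N = S n -> (Cmod tau < 1)%R ->
  is_cderive (primitive n) tau (kernel tau ^ n * ext (poincare Gamma N) tau).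
Proof.
intros HNn Ht; destruct Cmod_sub_pow as (K & K0 & HK).
destruct (disk_radius tau Ht) as [rho [H1 H2]].
replace (kernel tau ^ n * ext (poincare Gamma N) tau) with
  (usum Gamma (fun g => (g w - g z) ^ N *
     (position g tau ^ n * (1 - position g tau) ^ n * dposition g tau))).
  exact (is_cderive_series Gamma rho _ _ _ (sums_bounded_scal _ K B _ K0 hB) HK _ _ tau
    (tame_primitive n rho H2) H1).
rewrite (ext_eq _ tau Ht); apply usum_eq.
apply is_usum_ext with (fun g =>
  kernel tau ^ n * deriv g (exist (fun z => Cmod z < 1) tau Ht) ^ N).
  intros g Hg; rewrite HNn; symmetry.
  exact (substitution n g (exist (fun z => Cmod z < 1) tau Ht) Hg).
apply is_usum_scal, usum_correct, summable_deriv_pow.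
Qed.

Lemma primitive_endpoints (n : nat) : N = S n ->
  primitive n w - primitive n z = Beta N N * usum Gamma (fun g => (g w - g z) ^ N).
Proof.
intros HNn; assert (S := usum_correct _ _ summable_sub_pow).
replace (primitive n z) with (0 * usum Gamma (fun g => (g w - g z) ^ N)).
  replace (primitive n w) with (Beta N N * usum Gamma (fun g => (g w - g z) ^ N)).
    ring.
  symmetry; apply usum_eq; eapply is_usum_ext; [|apply is_usum_scal, S].
  intros g Hg; simpl; rewrite position_w, incomplete_beta_Beta, <- HNn by auto; ring.
symmetry; apply usum_eq; eapply is_usum_ext; [|apply is_usum_scal, S].
intros g Hg; simpl; rewrite position_z, incomplete_beta_0; ring.
Qed.

Lemma continuous_kernel_pow (n : nat) (tau : C) :
  continuous (fun x : C_UniformSpace => kernel x ^ n : C_UniformSpace) tau.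
Proof.
assert (H : continuous (kernel : C_UniformSpace -> C_UniformSpace) tau).
  apply continuous_is_cderive with ((w - tau - (tau - z)) / (w - z)).
  apply (is_cderive_quadratic _ _ _ (Cmod (/ (w - z))) 1); [lra|]; intros y _.
  unfold kernel; replace (_ - _) with (- (/ (w - z) * (y - tau) ^ 2)) by (field; auto).
  rewrite Cmod_opp, Cmod_mult, Cmod_pow; lra.
induction n as [|n IH]; [apply continuous_const|].
apply (continuous_Cmult (fun x => kernel x)); auto.
Qed.

Lemma path_integral_poincare (n : nat) (p : R -> C) : N = S n -> disk_path p z w ->
  is_path_integral (fun tau => kernel tau ^ n * ext (poincare Gamma N) tau) p
    (Beta N N * usum Gamma (fun g => (g w - g z) ^ N)).
Proof.
intros HNn (Hp & p0 & p1 & Hd).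
rewrite <- (primitive_endpoints n HNn), <- p0, <- p1.
apply is_RInt_path; auto.
  intros tau Ht; apply is_cderive_primitive; auto.
intros tau Ht; apply continuous_Cmult; [apply continuous_kernel_pow|].
destruct (holomorphic_poincare (exist (fun z => Cmod z < 1) tau Ht)) as [l Hl].
eapply continuous_is_cderive, Hl.
Qed.

End Series.

(** * The formula *)

Theorem corollary4 (Gamma : (disk -> disk) -> Prop) (k N : nat)
    (hGamma : uniformizes Gamma k) (hk : (2 <= k)%nat) (hN : (2 <= N)%nat) :
  (forall tau : disk, summable Gamma (fun g => deriv g tau ^ N)) /\
  holo_diff Gamma N (poincare Gamma N) /\
  (forall z w : disk,
     summable Gamma (fun g => (g w - g z) ^ N) /\
     is_I N (poincare Gamma N) z w (usum Gamma (fun g => (g w - g z) ^ N))).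
Proof.
assert (hF := uniformizes_fuchsian _ _ hGamma).
destruct (su11_choice Gamma hF) as (ca & cb & hab).
destruct (sums_bounded_weight Gamma k hGamma) as [B hB].
split; [intros tau; eapply summable_deriv_pow; eauto|].
split; [split; [eapply holomorphic_poincare; eauto|]|].
  intros g Hg z; eapply poincare_invariant; eauto.
intros z w.
assert (Sm : summable Gamma (fun g => (g w - g z) ^ N)) by (eapply summable_sub_pow; eauto).
split; [exact Sm|split].
- intros <-; apply usum_eq.
  replace (RtoC 0) with (0 * usum Gamma (fun g => (g z - g z) ^ N)) by ring.
  eapply is_usum_ext; [|apply is_usum_scal, usum_correct, Sm].
  intros g _; destruct N as [|n]; [lia|]; simpl.
  replace (g z - g z) with (RtoC 0) by ring; ring.
- intros zw p Hp.
  assert (zw' : (w : C) - z <> 0).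
    intros E; apply zw, disk_eq; replace (w : C) with ((w : C) - z + z) by ring.
    rewrite E; ring.
  destruct N as [|n]; [lia|]; replace (S n - 1)%nat with n by lia.
  exists (Beta (S n) (S n) * usum Gamma (fun g => (g w - g z) ^ S n)); split.
    exact (path_integral_poincare Gamma (S n) ca cb B hN hab hB z w zw' n p eq_refl Hp).
  field; intros E; apply RtoC_inj in E; generalize (Beta_pos n); lra.
Qed.
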